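(* Let $K_2$ be the virtual knot $4.21$ of Green's table of virtual knots and let $G(K_2)=G_A(K_2)$ be its group. Then: (1) The first five terms of the lower central series of $G(K_2)$ are different from each other. Moreover, $G(K_2)/\gamma_4G(K_2)\cong F_2/\gamma_4F_2$, $\ \gamma_4G(K_2)/\gamma_5G(K_2)\cong\mathbb{Z}^2\times\mathbb{Z}_4$, and $G(K_2)/\gamma_5G(K_2)\not\cong F_2/\gamma_5F_2$, where $F_2$ is the free group of rank 2. (2) The group $G(K_2)$ is an extension of a free group of rank 5 by an infinite cyclic group, i.e. it has a normal subgroup that is free of rank 5 with infinite cyclic quotient.
   Context: Conjugation: $x^{y}=y^{-1}xy$. Lower central series: $\gamma_1(G)=G$, $\gamma_{i+1}(G)=[\gamma_i(G),G]$. $\mathbb{Z}_m$ is the cyclic group of order $m$. The group $G_A(K)$ of a virtual knot $K$ is computed from a diagram: the diagram is divided into arcs running from one crossing (real or virtual) to the next, each arc gets a generator, there is one extra generator $y$, each real crossing gives a Wirtinger-type relation, and at each virtual crossing the generators on the two sides of the crossing along a strand are related by conjugation by $y^{\pm1}$. For the diagram of $K_2$ used here this group is $$G(K_2)=\langle x_1,\dots,x_{14},y\mid x_5x_{12}=x_{12}x_6,\ x_2x_{12}=x_{13}x_2,\ x_7x_3=x_3x_8,\ x_9x_1=x_1x_{10},\ x_3=x_2^{y},\ x_6=x_7^{y},\ x_{12}=x_{11}^{y},$$ $$x_4=x_5^{y},\ x_{14}=x_{13}^{y},\ x_1=x_2^{y},\ x_4=x_3^{y},\ x_8=x_9^{y},\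 x_1=x_{14}^{y},\ x_{10}=x_{11}^{y}\rangle,$$ and this presentation may be taken as the definition of $G(K_2)$. *)

(* Defs.v *)
From HB Require Import structures.
From mathcomp Require Import all_boot all_algebra.
From mathcomp Require Import generic_quotient boolp.

Set Implicit Arguments.
Unset Strict Implicit.
Unset Printing Implicit Defensive.

Local Open Scope group_scope.
Local Open Scope quotient_scope.

(* Possibly infinite groups are the [groupType]s of mathcomp.boot.monoid, with
   x ^ y = y^-1 * (x * y) and [~ x, y] = x^-1 * x ^ y.
   Subsets are boolean predicates; `[< P >] turns any proposition into a
   boolean classically, so no decidability restriction is involved. *)

Definition isomorphic (G H : groupType) : Prop :=
  exists2 f : G -> H, {morph f : x y / x * y} & bijective f.

HB.mixin Record isConjClosed (G : groupType) (S : {pred G}) := {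
  gpredJr : forall x y : G, x \in S -> x ^ y \in S
}.

#[short(type="normalClosed")]
HB.structure Definition NormalClosed (G : groupType) :=
  {S of isConjClosed G S & GroupClosed G S}.

Section Subgroup.
Variables (G : groupType) (H : groupClosed G).

Definition subgroup : Type := {x : G | x \in H}.

HB.instance Definition _ := SubChoice.on subgroup.

Lemma subgroup_closed : group_closed (fun x : G => x \in H).
Proof. by split; [exact: gpred1 | exact: gpredF]. Qed.

HB.instance Definition _ :=
  SubChoice_isSubGroup.Build G _ subgroup subgroup_closed.

(* S :&: H as a subset of the group H; for N normal in G and contained in H,
   the quotient group H / N is quotient_group (within H N). *)
Definition within (S : {pred G}) : {pred subgroup} :=
  fun u => val u \in S.

Lemma within_mul_closed (S : groupClosed G) : mulg_closed (within S).
Proof. by move=> u v uS vS; rewrite /in_mem /= /within valM gpredM. Qed.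
Lemma within_one (S : groupClosed G) : 1 \in within S.
Proof. by rewrite /in_mem /= /within val1 gpred1. Qed.
Lemma within_inv_closed (S : groupClosed G) : invg_closed (within S).
Proof. by move=> u uS; rewrite /in_mem /= /within gmulfV gpredV. Qed.
Lemma within_conj_closed (S : normalClosed G) (u v : subgroup) :
  u \in within S -> u ^ v \in within S.
Proof. by move=> uS; rewrite /in_mem /= /within gmulfJ gpredJr. Qed.

HB.instance Definition _ (S : groupClosed G) :=
  isMulClosed.Build _ (within S) (@within_mul_closed S).
HB.instance Definition _ (S : groupClosed G) :=
  isMul1Closed.Build _ (within S) (within_one S).
HB.instance Definition _ (S : groupClosed G) :=
  isInvClosed.Build _ (within S) (@within_inv_closed S).
HB.instance Definition _ (S : normalClosed G) :=
  isConjClosed.Build _ (within S) (@within_conj_closed S).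

End Subgroup.

Arguments within {G} H S.

Section Quotient.
Variables (G : groupType) (N : normalClosed G).

Definition quot_rel : rel G := fun x y => x^-1 * y \in N.

Lemma quot_rel_refl : reflexive quot_rel.
Proof. by move=> x; rewrite /quot_rel mulVg gpred1. Qed.
Lemma quot_rel_sym : symmetric quot_rel.
Proof. by move=> x y; rewrite /quot_rel -gpredV invgM invgK. Qed.
Lemma quot_rel_trans : transitive quot_rel.
Proof.
by move=> y x z xy yz; rewrite /quot_rel -(mulVKg y z) mulgA gpredM.
Qed.

Canonical quot_equiv :=
  EquivRel quot_rel quot_rel_refl quot_rel_sym quot_rel_trans.

Definition quotient_group : Type := {eq_quot quot_equiv}.
HB.instance Definition _ := Choice.on quotient_group.
HB.instance Definition _ := EqQuotient.on quotient_group.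

Definition qmul (a b : quotient_group) : quotient_group :=
  \pi_quotient_group (repr a * repr b).
Definition qinv (a : quotient_group) : quotient_group :=
  \pi_quotient_group (repr a)^-1.

Lemma quot_relP (x y : G) :
  reflect (x = y %[mod quotient_group]) (x^-1 * y \in N).
Proof. exact: (@eqmodP G quot_equiv x y). Qed.

Lemma qmul_pi (x y : G) :
  qmul (\pi_quotient_group x) (\pi_quotient_group y) =
  \pi_quotient_group (x * y).
Proof.
rewrite /qmul; set x' := repr _; set y' := repr _.
have /quot_relP xx' : x' = x %[mod quotient_group] by rewrite reprK.
have /quot_relP yy' : y' = y %[mod quotient_group] by rewrite reprK.
apply/quot_relP.
have -> : (x' * y')^-1 * (x * y) = (x'^-1 * x) ^ y' * (y'^-1 * y).
  by rewrite conjgE invgM !mulgA mulgK.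
by rewrite gpredM// gpredJr.
Qed.

Lemma qinv_pi (x : G) :
  qinv (\pi_quotient_group x) = \pi_quotient_group x^-1.
Proof.
rewrite /qinv; set x' := repr _.
have /quot_relP xx' : x = x' %[mod quotient_group] by rewrite reprK.
apply/quot_relP; rewrite invgK -gpredV.
have -> : (x' * x^-1)^-1 = (x^-1 * x')^-1 ^ x^-1.
  by rewrite conjgE !invgM !invgK !mulgA mulgK.
by rewrite gpredJr// gpredV.
Qed.

Lemma qmulA : associative qmul.
Proof.
elim/quotW=> x; elim/quotW=> y; elim/quotW=> z.
by rewrite (qmul_pi x y) (qmul_pi y z) !qmul_pi mulgA.
Qed.
Lemma qmul1g : left_id (\pi_quotient_group 1) qmul.
Proof. by elim/quotW=> x; rewrite qmul_pi mul1g. Qed.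
Lemma qmulg1 : right_id (\pi_quotient_group 1) qmul.
Proof. by elim/quotW=> x; rewrite qmul_pi mulg1. Qed.
Lemma qmulVg : left_inverse (\pi_quotient_group 1) qinv qmul.
Proof. by elim/quotW=> x; rewrite qinv_pi qmul_pi mulVg. Qed.
Lemma qmulgV : right_inverse (\pi_quotient_group 1) qinv qmul.
Proof. by elim/quotW=> x; rewrite qinv_pi qmul_pi mulgV. Qed.

HB.instance Definition _ :=
  isGroup.Build quotient_group qmulA qmul1g qmulg1 qmulVg qmulgV.

End Quotient.

Section Generation.
Variable G : groupType.
Implicit Types A B : {pred G}.

Definition generated A : {pred G} := fun x =>
  `[< forall H : {pred G}, group_closed H -> {subset A <= H} -> x \in H >].

Definition normal_closure A : {pred G} := fun x =>
  `[< forall H : {pred G}, group_closed H ->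
        (forall z y, z \in H -> z ^ y \in H) -> {subset A <= H} -> x \in H >].

Definition commutators A B : {pred G} := fun z =>
  `[< exists x y, [/\ x \in A, y \in B & z = [~ x, y]] >].

Lemma generated_closed A : group_closed (generated A).
Proof.
split; first by apply/asboolP=> H [].
move=> x y /asboolP xA /asboolP yA; apply/asboolP => H Hg AH.
by case: (Hg) => _; apply; [exact: xA | exact: yA].
Qed.

Lemma generated_conj A :
  (forall x y, x \in A -> x ^ y \in A) ->
  forall x y, x \in generated A -> x ^ y \in generated A.
Proof.
move=> AJ x y /asboolP xA; apply/asboolP => H [H1 HF] AH.
apply: (xA [pred z | z ^ y \in H]) => [|z zA]; last exact/AH/AJ.
split; first by rewrite inE conj1g.
by move=> u v; rewrite !inE conjMg conjVg; exact: HF.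
Qed.

Lemma normal_closure_closed A : group_closed (normal_closure A).
Proof.
split; first by apply/asboolP=> H [].
move=> x y /asboolP xA /asboolP yA; apply/asboolP => H Hg HJ AH.
by case: (Hg) => _; apply; [exact: xA | exact: yA].
Qed.

Lemma normal_closure_conj A x y :
  x \in normal_closure A -> x ^ y \in normal_closure A.
Proof.
move=> /asboolP xA; apply/asboolP => H Hg HJ AH.
exact/HJ/xA.
Qed.

Lemma normal_closure_one A : 1 \in normal_closure A.
Proof. by case: (normal_closure_closed A). Qed.

HB.instance Definition _ A := isMulClosed.Build G (normal_closure A)
  (group_closedM (normal_closure_closed A)).
HB.instance Definition _ A :=
  isMul1Closed.Build G (normal_closure A) (normal_closure_one A).
HB.instance Definition _ A := isInvClosed.Build G (normal_closure A)
  (group_closedV (normal_closure_closed A)).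
HB.instance Definition _ A :=
  isConjClosed.Build G (normal_closure A) (@normal_closure_conj A).

End Generation.

(* lcs G i is gamma_i(G) for i >= 1; by convention lcs G 0 = lcs G 1 = G. *)
Definition lcs (G : groupType) (i : nat) : {pred G} :=
  iter i.-1 (fun A => generated (commutators A predT)) predT.
Arguments lcs : clear implicits.

Section LowerCentralSeries.
Variable G : groupType.

Lemma lcs_closed i : group_closed (lcs G i).
Proof. by rewrite /lcs; case: i.-1 => // n; exact: generated_closed. Qed.

Lemma lcs_conj i (x y : G) : x \in lcs G i -> x ^ y \in lcs G i.
Proof.
rewrite /lcs; elim: i.-1 x y => // n IH; apply: generated_conj => z y.
move=> /asboolP[u [v [uA _ ->]]]; apply/asboolP.
by exists (u ^ y), (v ^ y); split=> //; [exact: IH | rewrite conjRg].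
Qed.

Lemma lcs_one i : 1 \in lcs G i.
Proof. by case: (lcs_closed i). Qed.

HB.instance Definition _ i :=
  isMulClosed.Build G (lcs G i) (group_closedM (lcs_closed i)).
HB.instance Definition _ i := isMul1Closed.Build G (lcs G i) (lcs_one i).
HB.instance Definition _ i :=
  isInvClosed.Build G (lcs G i) (group_closedV (lcs_closed i)).
HB.instance Definition _ i :=
  isConjClosed.Build G (lcs G i) (@lcs_conj i).

End LowerCentralSeries.

Section FreeGroup.
Variable X : choiceType.

(* The letter (x, true) stands for x and (x, false) for its inverse. *)
Definition word : Type := seq (X * bool).
HB.instance Definition _ := Choice.on word.

Inductive free_eq : word -> word -> Prop :=
| free_eq_refl u : free_eq u u
| free_eq_sym u v : free_eq u v -> free_eq v u
| free_eq_trans u v w : free_eq u v -> free_eq v w -> free_eq u w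
| free_eq_cat u u' v v' :
    free_eq u u' -> free_eq v v' -> free_eq (u ++ v) (u' ++ v')
| free_eq_cancel x b : free_eq [:: (x, b); (x, ~~ b)] [::].

Definition free_rel : rel word := fun u v => `[< free_eq u v >].

Lemma free_rel_refl : reflexive free_rel.
Proof. by move=> u; apply/asboolP; exact: free_eq_refl. Qed.
Lemma free_rel_sym : symmetric free_rel.
Proof. by move=> u v; apply/asboolP/asboolP; exact: free_eq_sym. Qed.
Lemma free_rel_trans : transitive free_rel.
Proof.
by move=> v u w /asboolP uv /asboolP vw; apply/asboolP/(free_eq_trans uv vw).
Qed.

Canonical free_equiv :=
  EquivRel free_rel free_rel_refl free_rel_sym free_rel_trans.

Definition free_group : Type := {eq_quot free_equiv}.
HB.instance Definition _ := Choice.on free_group.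
HB.instance Definition _ := EqQuotient.on free_group.

Definition winv (u : word) : word := rev [seq (a.1, ~~ a.2) | a <- u].

Lemma winv_cat u v : winv (u ++ v) = winv v ++ winv u.
Proof. by rewrite /winv map_cat rev_cat. Qed.

Lemma winvK : involutive winv.
Proof.
move=> u; rewrite /winv map_rev revK -map_comp -[RHS]map_id.
by apply: eq_map => -[x b] /=; rewrite negbK.
Qed.

Lemma free_eq_winv u v : free_eq u v -> free_eq (winv u) (winv v).
Proof.
elim=> {u v} [u|u v _|u v w _ uv _|u u' v v' _ IHu _ IHv|x b].
- exact: free_eq_refl.
- exact: free_eq_sym.
- exact: free_eq_trans.
- by rewrite !winv_cat; exact: free_eq_cat.
- by rewrite /winv /rev /= negbK; exact: free_eq_cancel.
Qed.

Lemma free_eq_catV u : free_eq (u ++ winv u) [::].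
Proof.
elim: u => [|[x b] u IH]; first exact: free_eq_refl.
rewrite -cat1s winv_cat catA -(catA [:: (x, b)]).
apply: (@free_eq_trans _ ([:: (x, b)] ++ winv [:: (x, b)])).
  apply: free_eq_cat; last exact: free_eq_refl.
  rewrite -[X in free_eq _ X]cats0.
  by apply: free_eq_cat => //; exact: free_eq_refl.
exact: free_eq_cancel.
Qed.

Lemma free_relP (u v : word) :
  reflect (u = v %[mod free_group]) `[< free_eq u v >].
Proof. exact: (@eqmodP word free_equiv u v). Qed.

Lemma free_repr (u : word) : free_eq (repr (\pi_free_group u)) u.
Proof. by apply/asboolP/free_relP; rewrite reprK. Qed.

Definition fmul (a b : free_group) : free_group :=
  \pi_free_group (repr a ++ repr b : word).
Definition finv (a : free_group) : free_group :=
  \pi_free_group (winv (repr a)).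

Lemma fmul_pi (u v : word) :
  fmul (\pi_free_group u) (\pi_free_group v) = \pi_free_group (u ++ v : word).
Proof.
by apply/free_relP/asboolP/free_eq_cat; exact: free_repr.
Qed.

Lemma finv_pi (u : word) :
  finv (\pi_free_group u) = \pi_free_group (winv u).
Proof. by apply/free_relP/asboolP/free_eq_winv; exact: free_repr. Qed.

Definition fone : free_group := \pi_free_group ([::] : word).

Lemma fmulA : associative fmul.
Proof.
elim/quotW=> u; elim/quotW=> v; elim/quotW=> w.
by rewrite (fmul_pi u v) (fmul_pi v w) !fmul_pi catA.
Qed.
Lemma fmul1g : left_id fone fmul.
Proof. by elim/quotW=> x; rewrite fmul_pi. Qed.
Lemma fmulg1 : right_id fone fmul.
Proof. by elim/quotW=> x; rewrite fmul_pi cats0. Qed.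
Lemma fmulgV : right_inverse fone finv fmul.
Proof.
elim/quotW=> u; rewrite finv_pi fmul_pi.
by apply/free_relP/asboolP; exact: free_eq_catV.
Qed.
Lemma fmulVg : left_inverse fone finv fmul.
Proof.
elim/quotW=> u; rewrite finv_pi fmul_pi.
apply/free_relP/asboolP; rewrite -[X in _ ++ X]winvK.
exact: free_eq_catV.
Qed.

HB.instance Definition _ :=
  isGroup.Build free_group fmulA fmul1g fmulg1 fmulVg fmulgV.

Definition fgen (x : X) : free_group := \pi_free_group ([:: (x, true)] : word).

End FreeGroup.

Definition relators (G : groupType) (rels : seq (G * G)) : {pred G} :=
  fun z => z \in [seq r.1 * r.2^-1 | r <- rels].

(* < X | r.1 = r.2 for r in rels > *)
Definition presented (X : choiceType) (rels : seq (free_group X * free_group X))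
  : groupType := quotient_group (normal_closure (relators rels)).

Definition F_ (n : nat) : groupType := free_group 'I_n.

(* [Algebra.to_multiplicative] turns the additive groups int and 'Z_4 into
   multiplicative ones. *)
Definition Zinf : groupType := Algebra.to_multiplicative int.
Definition Z4 : groupType := Algebra.to_multiplicative 'Z_4.

(* The presentation read off the diagram of the virtual knot 4.21, on the
   fifteen generators y (number 0) and x_1, ..., x_14 (numbers 1 to 14). *)
Definition K2_x (i : nat) : free_group 'I_15 := fgen (inord i).
Definition K2_y : free_group 'I_15 := fgen (inord 0).

Definition K2_relations : seq (free_group 'I_15 * free_group 'I_15) :=
  [:: (K2_x 5 * K2_x 12, K2_x 12 * K2_x 6);
      (K2_x 2 * K2_x 12, K2_x 13 * K2_x 2);
      (K2_x 7 * K2_x 3, K2_x 3 * K2_x 8);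
      (K2_x 9 * K2_x 1, K2_x 1 * K2_x 10);
      (K2_x 3, K2_x 2 ^ K2_y);
      (K2_x 6, K2_x 7 ^ K2_y);
      (K2_x 12, K2_x 11 ^ K2_y);
      (K2_x 4, K2_x 5 ^ K2_y);
      (K2_x 14, K2_x 13 ^ K2_y);
      (K2_x 1, K2_x 2 ^ K2_y);
      (K2_x 4, K2_x 3 ^ K2_y);
      (K2_x 8, K2_x 9 ^ K2_y);
      (K2_x 1, K2_x 14 ^ K2_y);
      (K2_x 10, K2_x 11 ^ K2_y)].

Definition G_K2 : groupType := presented K2_relations.

(* Main.v *)
(* Put a = x_2. The relations express every x_i through a and y and leave the
   single relation [a, W] = 1, where W = K2_word a y.

   For (2), put y_k = a^k y a^-k. The relation says that y_5 is a word in
   y_0, ..., y_4 in which y_0 occurs exactly once, so y_k |-> y_(k+1) extends to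
   an automorphism of the free group on y_0, ..., y_4, and G(K_2) is the
   semidirect product of that free group with the infinite cyclic group <a>.

   For (1), gamma_4 / gamma_5 of a group generated by a and y is spanned by
   [a,y,a,a], [a,y,a,y] and [a,y,y,y]. Affine maps f |-> u f + v over R[s]/(s^4)
   with u = 1 mod s form a group of class 4, and representations in such groups
   detect the coordinates of elements of gamma_n(F_2) modulo gamma_(n+1)(F_2).
   They show that [a, W] lies in gamma_4(F_2) and is congruent to
   [a,y,a,a]^4 [a,y,a,y]^-4 modulo gamma_5(F_2), so that [a,y,a,a] [a,y,a,y]^-1
   has order 4 in gamma_4(G) / gamma_5(G), whereas gamma_4(F_2) / gamma_5(F_2)
   is torsion-free. *)

Require Import Defs.
From mathcomp Require Import all_boot all_algebra.
From HB Require Import structures.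
From mathcomp Require Import generic_quotient boolp ring zify.

Set Implicit Arguments.
Unset Strict Implicit.
Unset Printing Implicit Defensive.

(** * Homomorphisms, quotients and presentations *)

Local Notation hom := UMagmaMorphism.type.

Lemma morph_divg (G H : groupType) (f : G -> H) :
  {morph f : x y / (x * y)%g} -> {morph f : x y / (x / y)%g}.
Proof. by move=> fM x y; apply: (mulIg (f y)); rewrite -fM !mulgVK. Qed.

(** Locked, so that a homomorphism is evaluated only through [hom_ofE]. *)
HB.lock Definition hom_of (G H : groupType) (f : G -> H)
    (fM : {morph f : x y / (x * y)%g}) : hom G H :=
  HB.pack f (isGroupMorphism.Build G H f (morph_divg fM)).

Lemma hom_ofE (G H : groupType) (f : G -> H)
    (fM : {morph f : x y / (x * y)%g}) x :
  hom_of fM x = f x.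
Proof. by rewrite unlock. Qed.

Section Homomorphisms.
Local Open Scope group_scope.
Implicit Types G H K : groupType.

Lemma hom_comp_subproof G H K (f : hom H K) (g : hom G H) :
  {morph f \o g : x z / x * z}.
Proof. by move=> x z /=; rewrite !gmulfM. Qed.

Definition hom_comp G H K (f : hom H K) (g : hom G H) : hom G K :=
  hom_of (hom_comp_subproof f g).

Lemma hom_compE G H K (f : hom H K) (g : hom G H) x :
  hom_comp f g x = f (g x).
Proof. by rewrite hom_ofE. Qed.

Lemma hom_id_subproof G : {morph (fun x : G => x) : x z / x * z}.
Proof. by []. Qed.
Definition hom_id G : hom G G := hom_of (@hom_id_subproof G).

Lemma hom_idE G x : hom_id G x = x.
Proof. by rewrite hom_ofE. Qed.

Lemma hom_conj_subproof G (a : G) :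
  {morph conjg^~ a : x z / x * z}.
Proof. by move=> x z; rewrite conjMg. Qed.
Definition hom_conj G (a : G) : hom G G :=
  hom_of (hom_conj_subproof a).

Lemma hom_conjE G (a x : G) : hom_conj a x = x ^ a.
Proof. by rewrite hom_ofE. Qed.

Lemma group_closed_generated G (A S : {pred G}) : group_closed S ->
  {subset A <= S} -> {subset generated A <= S}.
Proof. by move=> Sg AS x /asboolP; apply. Qed.

Lemma mem_generated G (A : {pred G}) : {subset A <= generated A}.
Proof. by move=> x xA; apply/asboolP => S _; apply. Qed.

Lemma hom_preim_closed G H (f : hom G H) (S : {pred H}) :
  group_closed S -> group_closed [pred x | f x \in S].
Proof.
move=> [S1 SF]; split; first by rewrite inE gmulf1.
by move=> x y; rewrite !inE gmulfF; exact: SF.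
Qed.

Lemma hom_eq_closed G H (f g : hom G H) :
  group_closed [pred x | f x == g x].
Proof.
split; first by rewrite inE !gmulf1.
by move=> x y; rewrite !inE !gmulfF => /eqP-> /eqP->.
Qed.

Lemma hom_eq_on_generators G H (A : {pred G}) (f g : hom G H) :
  (forall x, x \in generated A) -> {in A, f =1 g} -> f =1 g.
Proof.
move=> gA fg x; apply/eqP.
have := group_closed_generated (hom_eq_closed f g) _ (gA x).
by apply=> z zA; rewrite inE fg.
Qed.

(** Phrased as an induction principle: it applies directly to any subgroup predicate containing [a]
    and [y]. *)
Definition generating_pair G (a y : G) := forall S : {pred G},
  group_closed S -> a \in S -> y \in S -> forall x, x \in S.

Lemma generating_pair_hom_eq G H (a y : G) (f g : hom G H) :
  generating_pair a y -> f a = g a -> f y = g y -> f =1 g.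
Proof.
move=> gen_ay fga fgy x; apply/eqP.
by have := gen_ay _ (hom_eq_closed f g); apply; rewrite inE ?fga ?fgy.
Qed.

Section Quotient.
Variables (G : groupType) (N : normalClosed G).

Lemma quotient_proj_subproof : {morph \pi_(quotient_group N)%qT : x y / x * y}.
Proof. by move=> x y; rewrite -[LHS]qmul_pi. Qed.

Definition quotient_proj : hom G (quotient_group N) :=
  hom_of quotient_proj_subproof.

Lemma quotient_projP x z :
  reflect (quotient_proj x = quotient_proj z) (x^-1 * z \in N).
Proof. by rewrite /quotient_proj !hom_ofE; exact: quot_relP. Qed.

Lemma quotient_proj_eq1 x : (quotient_proj x == 1) = (x \in N).
Proof.
rewrite eq_sym -(@gmulf1 _ _ quotient_proj).
apply/idP/idP => [/eqP/quotient_projP|xN]; first by rewrite invg1 mul1g.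
by apply/eqP/quotient_projP; rewrite invg1 mul1g.
Qed.

Lemma quotient_proj_repr (q : quotient_group N) : quotient_proj (repr q) = q.
Proof. by rewrite hom_ofE reprK. Qed.

Variables (H : groupType) (f : hom G H).
Hypothesis fN : forall x, x \in N -> f x = 1.

(** The representative chosen for the coset of [x] differs from [x] by an element of [N], which [f]
    sends to 1. *)
Lemma quotient_lift_pi x : f (repr (quotient_proj x)) = f x.
Proof.
have /quotient_projP/fN :
    quotient_proj (repr (quotient_proj x)) = quotient_proj x.
  exact: quotient_proj_repr.
by rewrite gmulfM gmulfV => /(canRL (mulVKg _)); rewrite mulg1.
Qed.

Lemma quotient_lift_subproof :
  {morph (fun q : quotient_group N => f (repr q)) : x y / x * y}.
Proof.
move=> p q; rewrite -[in LHS](quotient_proj_repr p).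
by rewrite -[in LHS](quotient_proj_repr q) -gmulfM quotient_lift_pi gmulfM.
Qed.

Definition quotient_lift : hom (quotient_group N) H :=
  hom_of quotient_lift_subproof.

Lemma quotient_liftE x : quotient_lift (quotient_proj x) = f x.
Proof. by rewrite hom_ofE quotient_lift_pi. Qed.

End Quotient.

Lemma bij_isomorphic G H (f : hom G H) :
  injective f -> (forall h, exists x, f x = h) -> isomorphic G H.
Proof.
move=> f_inj f_surj; exists f; first exact: gmulfM.
pose g h := sval (cid (f_surj h)).
have gK : cancel g f by move=> h; rewrite /g; case: cid.
by exists g => // x; apply: f_inj; rewrite gK.
Qed.

Lemma isomorphic_sym G H : isomorphic G H -> isomorphic H G.
Proof.
case=> f fM [g fK gK]; exists g; last by exists f.
by move=> x z; apply: (canLR fK); rewrite fM !gK.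
Qed.

Lemma first_isomorphism G H (N : normalClosed G) (f : hom G H) :
  (forall x, (f x == 1) = (x \in N)) -> (forall h, exists x, f x = h) ->
  isomorphic (quotient_group N) H.
Proof.
move=> fN f_surj.
have fN1 x : x \in N -> f x = 1 by rewrite -fN => /eqP.
apply: (@bij_isomorphic _ _ (quotient_lift fN1)).
  apply: gmulf_inj => q; rewrite -(quotient_proj_repr q) quotient_liftE.
  by move/eqP; rewrite fN -quotient_proj_eq1 => /eqP.
move=> h; have [x <-] := f_surj h.
by exists (quotient_proj N x); exact: quotient_liftE.
Qed.

Section Kernel.
Variables (G H : groupType) (f : hom G H).

Definition hom_ker : {pred G} := fun x => f x == 1.

Lemma mem_hom_ker x : (x \in hom_ker) = (f x == 1). Proof. by []. Qed.

Lemma hom_ker_mul_closed : mulg_closed hom_ker.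
Proof.
by move=> x z; rewrite !mem_hom_ker gmulfM => /eqP-> /eqP->; rewrite mulg1.
Qed.
Lemma hom_ker_one : 1 \in hom_ker.
Proof. by rewrite mem_hom_ker gmulf1. Qed.
Lemma hom_ker_inv_closed : invg_closed hom_ker.
Proof. by move=> x; rewrite !mem_hom_ker gmulfV invg_eq1. Qed.
Lemma hom_ker_conj_closed x z : x \in hom_ker -> x ^ z \in hom_ker.
Proof. by rewrite !mem_hom_ker gmulfJ conjg_eq1. Qed.

HB.instance Definition _ := isMulClosed.Build _ hom_ker hom_ker_mul_closed.
HB.instance Definition _ := isMul1Closed.Build _ hom_ker hom_ker_one.
HB.instance Definition _ := isInvClosed.Build _ hom_ker hom_ker_inv_closed.
HB.instance Definition _ := isConjClosed.Build _ hom_ker hom_ker_conj_closed.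

End Kernel.

(** * Universal property of free groups *)

Section FreeHom.
Variables (X : choiceType) (H : groupType) (v : X -> H).

Definition letter_image (l : X * bool) : H := if l.2 then v l.1 else (v l.1)^-1.
Definition word_image (w : word X) : H := \prod_(l <- w) letter_image l.

Lemma word_image_free_eq u w : free_eq u w -> word_image u = word_image w.
Proof.
elim=> {u w} // [u w z _ -> _ ->|u u' w w' _ IHu _ IHw|x b] //.
  by rewrite /word_image !big_cat; congr (_ * _).
rewrite /word_image !big_cons big_nil mulg1 /letter_image /=.
by case: b => /=; rewrite ?mulgV ?mulVg.
Qed.

Lemma free_hom_subproof :
  {morph (fun q : free_group X => word_image (repr q)) : x y / x * y}.
Proof.
move=> p q; rewrite /word_image -big_cat; apply: word_image_free_eq.
exact: free_repr.
Qed.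

Definition free_hom : hom (free_group X) H := hom_of free_hom_subproof.

Lemma free_hom_gen x : free_hom (fgen x) = v x.
Proof.
rewrite hom_ofE (word_image_free_eq (free_repr _)).
by rewrite /word_image big_seq1.
Qed.

End FreeHom.

Lemma free_generated (X : choiceType) (q : free_group X) :
  q \in generated (fun z : free_group X => `[< exists x, z = fgen x >]).
Proof.
apply/asboolP=> S Sg genS.
have fS x : fgen x \in S by apply: genS; apply/asboolP; exists x.
rewrite -[q]reprK; elim: (repr q) => [|[x b] w IH]; first by case: Sg.
have -> : \pi_(free_group X)%qT ((x, b) :: w) =
    \pi_(free_group X)%qT [:: (x, b)] * \pi_(free_group X)%qT w.
  exact: esym (fmul_pi [:: (x, b)] w).
apply: (group_closedM Sg) => //; case: b; first exact: fS.
have := group_closedV Sg (fS x).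
by rewrite -[(fgen x)^-1]/(Defs.finv (fgen x)) finv_pi.
Qed.

Lemma free_hom_eq (X : choiceType) H (f g : hom (free_group X) H) :
  (forall x, f (fgen x) = g (fgen x)) -> f =1 g.
Proof.
move=> fg; apply: (hom_eq_on_generators (@free_generated X)) => z.
by case/asboolP=> x ->; exact: fg.
Qed.

(** * Universal property of a presentation *)

Section Presented.
Variables (X : choiceType) (rels : seq (free_group X * free_group X)).

Definition presented_gen x : presented rels := quotient_proj _ (fgen x).

Lemma presented_generated (q : presented rels) :
  q \in generated
    (fun z : presented rels => `[< exists x, z = presented_gen x >]).
Proof.
rewrite -[q]quotient_proj_repr; set p := quotient_proj _.
have pS := hom_preim_closed p (generated_closed _).
have := group_closed_generated (pS _) _ (free_generated (repr q)).
apply=> z /asboolP[x ->]; rewrite inE; apply: mem_generated.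
by apply/asboolP; exists x.
Qed.

Lemma presented_rel r : r \in rels ->
  quotient_proj (normal_closure (relators rels)) r.1 = quotient_proj _ r.2.
Proof.
move=> rr; apply/divg1_eq/eqP; rewrite -gmulfF quotient_proj_eq1.
apply/asboolP=> S _ _; apply; apply/mapP; by exists r.
Qed.

Variables (H : groupType) (v : X -> H).
Hypothesis v_rels : {in rels, forall r, free_hom v r.1 = free_hom v r.2}.

(** The kernel of [free_hom v] is a normal subgroup containing the relators, so it contains their
    normal closure. *)
Lemma presented_hom_subproof x :
  x \in normal_closure (relators rels) -> free_hom v x = 1.
Proof.
move=> /asboolP/(_ (hom_ker (free_hom v))) xK; apply/eqP; apply: xK.
- by split; [exact: gpred1|exact: gpredF].
- by move=> z y; exact: hom_ker_conj_closed.
- move=> z /mapP[r rr ->]; rewrite mem_hom_ker gmulfM gmulfV v_rels //.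
  by rewrite mulgV.
Qed.

Definition presented_hom : hom (presented rels) H :=
  quotient_lift presented_hom_subproof.

Lemma presented_hom_gen x : presented_hom (presented_gen x) = v x.
Proof. by rewrite -(free_hom_gen v); exact: quotient_liftE. Qed.

End Presented.

End Homomorphisms.

(** * Lower central series of a two-generator group *)

Section LowerCentralSeriesTheory.
Local Open Scope group_scope.
Implicit Types G H : groupType.

Section IntegerPowers.
Variable G : groupType.
Implicit Types (x z : G) (m n : int).

Definition expgz x n : G :=
  match n with Posz k => x ^+ k | Negz k => x ^- k.+1 end.

Lemma expgzS x n : expgz x (n + 1)%R = x * expgz x n.
Proof.
case: n => [k|[|k]]; first by rewrite -PoszD addn1 /= expgS.
  by rewrite mulgV.
have -> : (Negz k.+1 + 1 = Negz k)%R by lia.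
by rewrite /= [x ^+ k.+2]expgSr invgM mulVKg.
Qed.

Lemma expgzD x m n : expgz x (m + n)%R = expgz x m * expgz x n.
Proof.
elim/int_rec: m => [|k IH|k IH]; first by rewrite GRing.add0r mul1g.
  rewrite -addn1 PoszD (GRing.addrAC _ 1%R) !expgzS IH.
  by rewrite mulgA.
apply: (mulgI x); rewrite -expgzS mulgA -expgzS -addn1 PoszD GRing.opprD.
by rewrite (GRing.addrAC _ _ n) !GRing.addrNK.
Qed.

Lemma expgzN x n : expgz x (- n)%R = (expgz x n)^-1.
Proof. by apply/esym/mulg1_eq; rewrite -expgzD GRing.subrr. Qed.

Lemma expgzB x m n : expgz x (m - n)%R = expgz x m / expgz x n.
Proof. by rewrite expgzD expgzN. Qed.

Lemma expg1z n : expgz 1 n = 1.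
Proof. by case: n => n /=; rewrite ?expg1n ?invg1. Qed.

Lemma expgzM x m n : expgz x (m * n)%R = expgz (expgz x n) m.
Proof.
elim/int_rec: m => [|m IH|m IH]; first by rewrite GRing.mul0r.
  by rewrite -addn1 PoszD GRing.mulrDl GRing.mul1r !expgzD IH.
by rewrite -addn1 PoszD GRing.opprD GRing.mulrDl GRing.mulN1r !expgzB IH.
Qed.

Lemma expgz_closed (S : {pred G}) x n :
  group_closed S -> x \in S -> expgz x n \in S.
Proof.
move=> Sg xS; have SX k : x ^+ k \in S.
  elim: k => [|k IH]; first by case: Sg.
  by rewrite expgS; exact: (group_closedM Sg).
by case: n => k //=; exact: (group_closedV Sg).
Qed.

End IntegerPowers.

Lemma hom_expgz G H (f : hom G H) x n : f (expgz x n) = expgz (f x) n.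
Proof. by case: n => k /=; rewrite (gmulfXn, gmulfXVn). Qed.

Section LcsBasics.
Variable G : groupType.
Implicit Types (x z : G) (n : nat).

(** Indices are shifted to [n.+1] because [lcs G 0] and [lcs G 1] are both the whole group: the
    recursion defining the series starts at 1. *)
Lemma lcs_commg n x z : x \in lcs G n.+1 -> [~ x, z] \in lcs G n.+2.
Proof. by move=> xn; apply: mem_generated; apply/asboolP; exists x, z. Qed.

Lemma lcs_min n (T : {pred G}) : group_closed T ->
  (forall x z, x \in lcs G n.+1 -> [~ x, z] \in T) ->
  {subset lcs G n.+2 <= T}.
Proof.
move=> Tg cT; apply: group_closed_generated => // _ /asboolP[x [z [xn _ ->]]].
exact: cT.
Qed.

Lemma lcsS_sub n : {subset lcs G n.+1 <= lcs G n}.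
Proof.
case: n => // n; apply: lcs_min; first exact: lcs_closed.
by move=> x z xn; rewrite commgEl gpredM ?gpredV ?lcs_conj.
Qed.

Lemma lcs_sub m n : m <= n -> {subset lcs G n <= lcs G m}.
Proof.
move/subnK <-; elim: (n - m) => // k IH x xk.
by apply: IH; apply: lcsS_sub.
Qed.

Lemma lcs_stable n : lcs G n.+1 =i lcs G n.+2 -> lcs G n.+2 =i lcs G n.+3.
Proof.
move=> en x; apply/idP/idP; last exact: lcsS_sub.
apply: lcs_min; first exact: lcs_closed.
by move=> u v; rewrite en; exact: lcs_commg.
Qed.

End LcsBasics.

Lemma hom_lcs G H (f : hom G H) n x : x \in lcs G n -> f x \in lcs H n.
Proof.
case: n => // n; elim: n x => // n IH.
suff: {subset lcs G n.+2 <= [pred x | f x \in lcs H n.+2]} by [].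
apply: lcs_min; first exact/hom_preim_closed/lcs_closed.
by move=> x z xn; rewrite inE gmulfR; apply: lcs_commg; exact: IH.
Qed.

(** Commutators in the quotient lift to commutators of lifted elements, by induction along the
    series. *)
Lemma lcs_quotient G (N : normalClosed G) n (q : quotient_group N) :
  q \in lcs (quotient_group N) n ->
  exists2 x, x \in lcs G n & q = quotient_proj N x.
Proof.
case: n => [_|n]; first by exists (repr q); rewrite // quotient_proj_repr.
elim: n q => [q _|n IH q].
  by exists (repr q); rewrite // quotient_proj_repr.
pose T : {pred quotient_group N} := fun q =>
  `[< exists2 x, x \in lcs G n.+2 & q = quotient_proj N x >].
suff TP : {subset lcs (quotient_group N) n.+2 <= T} by move/TP/asboolP.
apply: lcs_min.
  split; first by apply/asboolP; exists 1; rewrite ?gpred1 ?gmulf1.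
  move=> u v /asboolP[x xn ->] /asboolP[z zn ->]; apply/asboolP.
  by exists (x / z); rewrite ?gpredF // gmulfF.
move=> u v /IH[x xn ->]; rewrite -(quotient_proj_repr v) -gmulfR.
by apply/asboolP; exists [~ x, repr v] => //; exact: lcs_commg.
Qed.

Lemma lcs_quotient_lcs G n (q : quotient_group (lcs G n)) :
  q \in lcs (quotient_group (lcs G n)) n -> q = 1.
Proof.
by case/lcs_quotient => x xn ->; apply/eqP; rewrite quotient_proj_eq1.
Qed.

(** * Spanning families for the first four lower central factors *)

Section Span.
Variable G : groupType.
Implicit Types (x z s t : G) (n : nat).

(** Three slots suffice: the factors of a two-generator group up to the fourth need 2, 1, 2 and 3
    generators. Empty slots are filled with 1. *)
Definition lcs_span n s1 s2 s3 : {pred G} := fun x =>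
  `[< exists p q r, exists2 z, z \in lcs G n.+1
      & x = expgz s1 p * expgz s2 q * expgz s3 r * z >].

Lemma lcs_central n x (q : quotient_group (lcs G n.+2)) : x \in lcs G n.+1 ->
  commute q (quotient_proj _ x).
Proof.
move=> xn; rewrite -(quotient_proj_repr q); apply/commute_sym/commgP.
by rewrite -gmulfR quotient_proj_eq1; exact: lcs_commg.
Qed.

(** Modulo [lcs G n.+2] the elements [t1], [t2], [t3] are central, so exponents subtract when two
    such products are divided. *)
Lemma lcs_span_closed n t1 t2 t3 : t1 \in lcs G n.+1 -> t2 \in lcs G n.+1 ->
  t3 \in lcs G n.+1 -> group_closed (lcs_span n.+1 t1 t2 t3).
Proof.
move=> t1n t2n t3n; pose P := quotient_proj (lcs G n.+2).
pose M p q r := expgz t1 p * expgz t2 q * expgz t3 r.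
have spanP x :
    reflect (exists p q r, P x = P (M p q r)) (x \in lcs_span n.+1 t1 t2 t3).
  apply: (iffP idP) => [/asboolP[p [q [r [z zn ->]]]]|[p [q [r e]]]].
    exists p, q, r; rewrite gmulfM (_ : P z = 1) ?mulg1 //.
    by apply/eqP; rewrite quotient_proj_eq1.
  apply/asboolP; exists p, q, r; exists ((M p q r)^-1 * x).
    exact/quotient_projP/esym.
  by rewrite -/(M p q r) mulVKg.
split.
  by apply/spanP; exists 0%R, 0%R, 0%R; rewrite /M /= !mulg1.
move=> x x' /spanP[p [q [r e]]] /spanP[p' [q' [r' e']]]; apply/spanP.
exists (p - p')%R, (q - q')%R, (r - r')%R.
have PV u : P u^-1 = (P u)^-1 by rewrite gmulfV.
have ex t k : t \in lcs G n.+1 -> expgz t k \in lcs G n.+1.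
  exact/expgz_closed/lcs_closed.
have cV t k (u : quotient_group _) :
    t \in lcs G n.+1 -> (P (expgz t k))^-1 * u = u * (P (expgz t k))^-1.
  by move=> tn; apply/esym/commuteV/lcs_central/ex.
rewrite gmulfM PV e e' /M !expgzB !gmulfM !PV !invgM -!mulgA.
by rewrite [in RHS](cV t2) // -?mulgA [in RHS](cV t1) // -?mulgA.
Qed.

(* Modulo lcs n.+3, the commutator [~ u, v] with u in lcs n.+1 is multiplicative
   in u and in v, so lcs n.+2 is spanned by commutators of generators. *)
Lemma lcs_span_step n a y s1 s2 s3 (T : {pred G}) :
  generating_pair a y ->
  {subset lcs G n.+1 <= lcs_span n.+1 s1 s2 s3} ->
  s1 \in lcs G n.+1 -> s2 \in lcs G n.+1 -> s3 \in lcs G n.+1 ->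
  group_closed T -> {subset lcs G n.+3 <= T} ->
  (forall s, s \in [:: s1; s2; s3] -> [~ s, a] \in T /\ [~ s, y] \in T) ->
  {subset lcs G n.+2 <= T}.
Proof.
move=> gen_ay sp s1n s2n s3n Tg nT sT.
have TM := group_closedM Tg; have TV := group_closedV Tg.
(* Conjugation changes [x] by the factor [[~ x, g]], which already lies in [T]. *)
have TJ x g : x \in lcs G n.+2 -> x \in T -> x ^ g \in T.
  move=> xn xT; rewrite -(mulVKg x (x ^ g)) -commgEl TM //.
  by apply: nT; exact: lcs_commg.
(* [B] is a subgroup by multiplicativity in the first argument; multiplicativity in the second one,
   through the subgroup [D] below, puts each [s] into [B]. *)
pose B : {pred G} :=
  fun u => (u \in lcs G n.+1) && `[< forall v, [~ u, v] \in T >].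
have memB u :
    (u \in B) = (u \in lcs G n.+1) && `[< forall v, [~ u, v] \in T >].
  by [].
have Bg : group_closed B.
  split.
    rewrite memB gpred1; apply/asboolP => v.
    by rewrite comm1g; case: Tg.
  move=> u u'; rewrite 2!memB => /andP[un /asboolP uT] /andP[un' /asboolP uT'].
  rewrite memB gpredF //; apply/asboolP => v.
  have -> : [~ u / u', v] = [~ u, v] ^ u'^-1 * ([~ u', v]^-1) ^ u'^-1.
    by rewrite /commg /conjg !gnorm.
  by rewrite TM // TJ // ?gpredV ?lcs_commg // TV.
have sB s : s \in lcs G n.+1 -> s \in [:: s1; s2; s3] -> s \in B.
  move=> sn /sT[saT syT]; rewrite memB sn; apply/asboolP.
  pose D : {pred G} := fun v => [~ s, v] \in T.
  have memD v : (v \in D) = ([~ s, v] \in T) by [].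
  apply: (gen_ay D) => //.
  split; first by rewrite memD commg1; case: Tg.
  move=> v v'; rewrite !memD => vT vT'.
  have -> : [~ s, v / v'] = ([~ s, v']^-1) ^ v'^-1 * [~ s, v] ^ v'^-1.
    by rewrite /commg /conjg !gnorm.
  by rewrite TM // TJ // ?gpredV ?lcs_commg // TV.
apply: lcs_min => // x z /sp/asboolP[p [q [r [w wn ->]]]].
have wB : w \in B.
  rewrite memB lcsS_sub //; apply/asboolP => v.
  by apply: nT; exact: lcs_commg.
have BM := group_closedM Bg.
suff : expgz s1 p * expgz s2 q * expgz s3 r * w \in B.
  by rewrite memB => /andP[_ /asboolP]; apply.
have sX s k : s \in lcs G n.+1 -> s \in [:: s1; s2; s3] -> expgz s k \in B.
  by move=> sn ss; apply: expgz_closed => //; exact: sB.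
apply: (BM) => //; apply: (BM); [apply: (BM)|].
all: by apply: sX; rewrite // !inE eqxx ?orbT.
Qed.

Variables a y : G.
Hypothesis gen_ay : generating_pair a y.

Definition comm_ay := [~ a, y].
Definition comm_aya := [~ comm_ay, a].
Definition comm_ayy := [~ comm_ay, y].
Definition comm_ayaa := [~ comm_aya, a].
Definition comm_ayay := [~ comm_aya, y].
Definition comm_ayyy := [~ comm_ayy, y].

(* [x, [u, v]] compares x'^(uv) with x'^(vu), where x = x'^(vu). *)
Lemma lcs_commg_commg n x u v : x \in lcs G n.+1 ->
  [~ x, [~ u, v]] \in lcs G n.+3.
Proof.
move=> xn; pose x' := x ^ (v * u)^-1.
have x'n : x' \in lcs G n.+1 by exact: lcs_conj.
have -> : [~ x, [~ u, v]] = [~ [~ x', v], u]^-1 * [~ [~ x', v], [~ x', u]]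
    * [~ [~ x', u], v].
  by rewrite /x' /commg /conjg !gnorm.
apply: gpredM; last exact/lcs_commg/lcs_commg.
by apply: gpredM; [rewrite gpredV|]; exact/lcs_commg/lcs_commg.
Qed.

Lemma lcs_span_sub n s1 s2 s3 : {subset lcs G n.+1 <= lcs_span n s1 s2 s3}.
Proof.
move=> x xn; apply/asboolP; exists 0%R, 0%R, 0%R, x => //.
by rewrite !mul1g.
Qed.

Lemma lcs_span1 : {subset lcs G 1 <= lcs_span 1 a y 1}.
Proof.
move=> x _; apply: gen_ay; first exact: lcs_span_closed.
  by apply/asboolP; exists 1%R, 0%R, 0%R, 1; rewrite ?gpred1 //= !mulg1.
by apply/asboolP; exists 0%R, 1%R, 0%R, 1; rewrite ?gpred1 //= !mulg1 mul1g.
Qed.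

Lemma mem_lcs_span1 n s1 s2 s3 : s1 \in lcs_span n s1 s2 s3.
Proof.
by apply/asboolP; exists 1%R, 0%R, 0%R, 1; rewrite ?gpred1 //= !mulg1.
Qed.

Lemma mem_lcs_span2 n s1 s2 s3 : s2 \in lcs_span n s1 s2 s3.
Proof.
by apply/asboolP; exists 0%R, 1%R, 0%R, 1; rewrite ?gpred1 //= !mulg1 mul1g.
Qed.

Lemma mem_lcs_span3 n s1 s2 s3 : s3 \in lcs_span n s1 s2 s3.
Proof.
by apply/asboolP; exists 0%R, 0%R, 1%R, 1; rewrite ?gpred1 //= !mulg1 !mul1g.
Qed.

Lemma comm_ay_lcs : comm_ay \in lcs G 2.
Proof. exact: lcs_commg. Qed.

Lemma comm_aya_lcs : comm_aya \in lcs G 3.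
Proof. exact/lcs_commg/comm_ay_lcs. Qed.

Lemma comm_ayy_lcs : comm_ayy \in lcs G 3.
Proof. exact/lcs_commg/comm_ay_lcs. Qed.

Lemma comm_ayaa_lcs : comm_ayaa \in lcs G 4.
Proof. exact/lcs_commg/comm_aya_lcs. Qed.

Lemma comm_ayay_lcs : comm_ayay \in lcs G 4.
Proof. exact/lcs_commg/comm_aya_lcs. Qed.

Lemma comm_ayyy_lcs : comm_ayyy \in lcs G 4.
Proof. exact/lcs_commg/comm_ayy_lcs. Qed.

(** The commutators of generators are trivial except [[~ a, y]] and its inverse [[~ y, a]]. *)
Lemma lcs_span2 : {subset lcs G 2 <= lcs_span 2 comm_ay 1 1}.
Proof.
have Tg : group_closed (lcs_span 2 comm_ay 1 1).
  by apply: lcs_span_closed; rewrite ?gpred1 ?comm_ay_lcs.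
have [T1 _] := Tg; have TV := group_closedV Tg.
have cT : comm_ay \in lcs_span 2 comm_ay 1 1 by exact: mem_lcs_span1.
apply: (lcs_span_step gen_ay lcs_span1) => //; first exact: lcs_span_sub.
move=> s; rewrite !inE => /or3P[]/eqP->; rewrite ?commgg ?comm1g //.
by rewrite -invgR TV.
Qed.

Lemma lcs_span3 : {subset lcs G 3 <= lcs_span 3 comm_aya comm_ayy 1}.
Proof.
have Tg : group_closed (lcs_span 3 comm_aya comm_ayy 1).
  by apply: lcs_span_closed; rewrite ?gpred1 ?comm_aya_lcs ?comm_ayy_lcs.
have [T1 _] := Tg.
apply: (lcs_span_step gen_ay lcs_span2) => //; rewrite ?gpred1 ?comm_ay_lcs //.
  exact: lcs_span_sub.
move=> s; rewrite !inE => /or3P[]/eqP->; rewrite ?comm1g //.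
by split; [exact: mem_lcs_span1|exact: mem_lcs_span2].
Qed.

Lemma lcs_span4 : {subset lcs G 4 <= lcs_span 4 comm_ayaa comm_ayay comm_ayyy}.
Proof.
have Tg : group_closed (lcs_span 4 comm_ayaa comm_ayay comm_ayyy).
  apply: lcs_span_closed;
    rewrite ?comm_ayaa_lcs ?comm_ayay_lcs ?comm_ayyy_lcs //.
have [T1 _] := Tg; have TM := group_closedM Tg.
have subT := @lcs_span_sub 4 comm_ayaa comm_ayay comm_ayyy.
apply: (lcs_span_step gen_ay lcs_span3) => //;
  rewrite ?gpred1 ?comm_aya_lcs ?comm_ayy_lcs //.
move=> s; rewrite !inE => /or3P[]/eqP->; rewrite ?comm1g //.
  by split; [exact: mem_lcs_span1|exact: mem_lcs_span2].
split; last exact: mem_lcs_span3.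
(* With c = [a, y], the commutators [c,a,y] and [c,y,a] agree modulo lcs 5:
   compare c^(ya) with c^(ay) = (c^(ya))^c. *)
pose c3 := comm_aya * comm_ayy * [~ comm_ayy, a].
(* Here [c3] is the commutator of c with ya. Both correcting factors are commutators of an element
   of [lcs G 3] with a commutator, hence lie in [lcs G 5]. *)
have -> : [~ comm_ayy, a] =
    [~ comm_ayy, comm_aya] * comm_ayay * [~ c3, comm_ay]^-1.
  by rewrite /c3 /comm_ayay /comm_aya /comm_ayy /comm_ay /commg /conjg !gnorm.
have c3n : c3 \in lcs G 3.
  apply: gpredM; last by apply/lcsS_sub/lcs_commg/comm_ayy_lcs.
  by apply: gpredM; [exact: comm_aya_lcs|exact: comm_ayy_lcs].
apply: (TM); last by rewrite subT // gpredV lcs_commg_commg.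
apply: (TM); last exact: mem_lcs_span2.
by rewrite subT // lcs_commg_commg // comm_ayy_lcs.
Qed.

End Span.
End LowerCentralSeriesTheory.

(** * Truncated affine groups *)

Section TruncatedAffineGroup.
Variable R : comNzRingType.

(* ((u1, u2, u3), (v0, v1, v2, v3)) stands for the affine map f |-> u f + v of
   R[s]/(s^4), where u = 1 + u1 s + u2 s^2 + u3 s^3 and
   v = v0 + v1 s + v2 s^2 + v3 s^3. *)
Definition aff : Type := ((R * R * R) * (R * R * R * R))%type.

HB.instance Definition _ := Choice.on aff.

Local Open Scope ring_scope.
Import GRing.Theory.

(** The composite of the two affine maps, [h] being applied first. *)
Definition aff_mul (g h : aff) : aff :=
  let: ((u1, u2, u3), (v0, v1, v2, v3)) := g in
  let: ((t1, t2, t3), (w0, w1, w2, w3)) := h in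
  ((u1 + t1, u2 + u1 * t1 + t2, u3 + u2 * t1 + u1 * t2 + t3),
   (v0 + w0, v1 + (w1 + u1 * w0), v2 + (w2 + u1 * w1 + u2 * w0),
    v3 + (w3 + u1 * w2 + u2 * w1 + u3 * w0))).

Definition aff_one : aff := ((0, 0, 0), (0, 0, 0, 0)).

(** The map f |-> u^-1 f - u^-1 v, where [t1], [t2], [t3] are the coefficients of u^-1 modulo
    s^4. *)
Definition aff_inv (g : aff) : aff :=
  let: ((u1, u2, u3), (v0, v1, v2, v3)) := g in
  let t1 := - u1 in
  let t2 := u1 ^+ 2 - u2 in
  let t3 := (u1 * u2) *+ 2 - u1 ^+ 3 - u3 in
  ((t1, t2, t3),
   (- v0, - (v1 + t1 * v0), - (v2 + t1 * v1 + t2 * v0),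
    - (v3 + t1 * v2 + t2 * v1 + t3 * v0))).

Lemma aff_mulA : associative aff_mul.
Proof.
move=> [[[u1 u2] u3] [[[v0 v1] v2] v3]] [[[t1 t2] t3] [[[w0 w1] w2] w3]].
move=> [[[x1 x2] x3] [[[z0 z1] z2] z3]].
by rewrite /=; congr ((_, _, _), (_, _, _, _)); ring.
Qed.

Lemma aff_mul1 : left_id aff_one aff_mul.
Proof.
move=> [[[u1 u2] u3] [[[v0 v1] v2] v3]].
by rewrite /=; congr ((_, _, _), (_, _, _, _)); ring.
Qed.

Lemma aff_mul1r : right_id aff_one aff_mul.
Proof.
move=> [[[u1 u2] u3] [[[v0 v1] v2] v3]].
by rewrite /=; congr ((_, _, _), (_, _, _, _)); ring.
Qed.

Lemma aff_mulV : left_inverse aff_one aff_inv aff_mul.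
Proof.
move=> [[[u1 u2] u3] [[[v0 v1] v2] v3]].
by rewrite /=; congr ((_, _, _), (_, _, _, _)); ring.
Qed.

Lemma aff_mulVr : right_inverse aff_one aff_inv aff_mul.
Proof.
move=> [[[u1 u2] u3] [[[v0 v1] v2] v3]].
by rewrite /=; congr ((_, _, _), (_, _, _, _)); ring.
Qed.

HB.instance Definition _ :=
  isGroup.Build aff aff_mulA aff_mul1 aff_mul1r aff_mulV aff_mulVr.

Definition aff_u1 (g : aff) : R := g.1.1.1.
Definition aff_v0 (g : aff) : R := g.2.1.1.1.
Definition aff_v1 (g : aff) : R := g.2.1.1.2.
Definition aff_v2 (g : aff) : R := g.2.1.2.
Definition aff_v3 (g : aff) : R := g.2.2.

(** For n from 2 to 5 these are the translations by multiples of s^(n-1), only the identity when n =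
    5; for n at most 1 it is the whole group. *)
Definition aff_filt n : {pred aff} := fun g =>
  [&& (1 < n)%N ==> (g.1 == 0) && (aff_v0 g == 0),
      (2 < n)%N ==> (aff_v1 g == 0),
      (3 < n)%N ==> (aff_v2 g == 0) & (4 < n)%N ==> (aff_v3 g == 0)].

(* The coefficient of s in [u] if n = 1, and of s^(n-1) in [v] if n > 1. *)
Definition aff_symbol n : aff -> R :=
  match n with 1 => aff_u1 | 2 => aff_v1 | 3 => aff_v2 | _ => aff_v3 end.

Lemma aff_filt_inv n (g : aff) : (1 < n)%N -> g \in aff_filt n ->
  exists v1 v2 v3, [/\ g = ((0, 0, 0), (0, v1, v2, v3)), (2 < n)%N -> v1 = 0,
    (3 < n)%N -> v2 = 0 & (4 < n)%N -> v3 = 0].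
Proof.
case: g => [u [[[v0 v1] v2] v3]] n1.
rewrite /in_mem /= /aff_filt n1 /= => /and4P[/andP[/eqP/= -> /eqP/= v0E]].
rewrite /aff_v0 /= in v0E; rewrite v0E /aff_v1 /aff_v2 /aff_v3 /=.
move=> /implyP v1E /implyP v2E /implyP v3E.
by exists v1, v2, v3; split=> // nk; apply/eqP; auto.
Qed.

Lemma aff_filt_closed n : group_closed (aff_filt n).
Proof.
have [n1|n1] := leqP n 1.
  have aT g : g \in aff_filt n.
    by rewrite /in_mem /= /aff_filt !ltnNge !(leq_trans n1).
  by split.
split.
  rewrite /in_mem /= /aff_filt /= /aff_v0 /aff_v1 /aff_v2 /aff_v3 /=.
  by rewrite !eqxx !implybT.
move=> g h /(aff_filt_inv n1)[v1 [v2 [v3 [-> v1E v2E v3E]]]].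
move=> /(aff_filt_inv n1)[w1 [w2 [w3 [-> w1E w2E w3E]]]].
rewrite /in_mem /= /aff_filt; apply/and4P.
rewrite /aff_v0 /aff_v1 /aff_v2 /aff_v3; split; apply/implyP => nk;
  rewrite /= ?(v1E nk) ?(v2E nk) ?(v3E nk) ?(w1E nk) ?(w2E nk) ?(w3E nk).
- by apply/andP; split; apply/eqP; [congr (_, _, _)|]; ring.
all: by apply/eqP; ring.
Qed.

(** Linear parts commute and are 1 modulo s, so a commutator is a translation by a multiple of s.
    Commuting a translation by v with a map of linear part t gives the translation by (t^-1 - 1) v,
    which gains a factor s. *)
Lemma lcs_aff n : (n <= 5)%N -> {subset lcs aff n <= aff_filt n}.
Proof.
have [n1 _|] := leqP n 1.
  by move=> g _; rewrite /in_mem /= /aff_filt !ltnNge !(leq_trans n1).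
case: n => [|[|n]] // _; elim: n => [_|n IH n5].
  apply: lcs_min; first exact: aff_filt_closed.
  move=> [[[u1 u2] u3] [[[v0 v1] v2] v3]] [[[t1 t2] t3] [[[w0 w1] w2] w3]] _.
  rewrite /in_mem /= /aff_filt /= /aff_v0 /= !andbT; apply/andP.
  by split; apply/eqP; [congr (_, _, _)|]; ring.
apply: lcs_min; first exact: aff_filt_closed.
move=> g h /(IH (ltnW n5))/(@aff_filt_inv n.+2 _ isT).
move=> [v1 [v2 [v3 [-> v1E v2E v3E]]]].
case: h => [[[t1 t2] t3] [[[w0 w1] w2] w3]].
rewrite /in_mem /= /aff_filt /aff_v0 /aff_v1 /aff_v2 /aff_v3 {IH}.
apply/and4P; split; apply/implyP => nk; rewrite /=.
- by apply/andP; split; apply/eqP; [congr (_, _, _)|]; rewrite /=; ring.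
- by apply/eqP; ring.
- by rewrite (v1E nk); apply/eqP; ring.
- by rewrite (v1E (ltnW nk)) (v2E nk); apply/eqP; ring.
Qed.

(** For n = 1 the coefficient of s is additive in a product of series with constant term 1; for
    larger n the elements are translations. *)
Lemma aff_symbolM n (g h : aff) : (0 < n < 5)%N -> g \in aff_filt n ->
  h \in aff_filt n -> aff_symbol n (g * h)%g = aff_symbol n g + aff_symbol n h.
Proof.
case/andP => n0 n5; have [n1 _ _|n1] := leqP n 1.
  have -> : n = 1%N by apply/eqP; rewrite eqn_leq n1.
  by case: g h => [[[? ?] ?] [[[? ?] ?] ?]] [[[? ?] ?] [[[? ?] ?] ?]].
move=> /(aff_filt_inv n1)[v1 [v2 [v3 [-> _ _ _]]]].
move=> /(aff_filt_inv n1)[w1 [w2 [w3 [-> _ _ _]]]].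
case: n n0 n1 n5 => [|[|[|[|[|]]]]] //= _ _ _;
  by rewrite /aff_v1 /aff_v2 /aff_v3 /=; ring.
Qed.

Lemma aff_symbol0 n (g : aff) : (0 < n < 5)%N -> g \in aff_filt n.+1 ->
  aff_symbol n g = 0.
Proof.
case: n => // n n5 /(@aff_filt_inv n.+2 _ isT)[v1 [v2 [v3 [-> v1E v2E v3E]]]].
case: n n5 v1E v2E v3E => [|[|[|[|n]]]] //= _ v1E v2E v3E;
  by rewrite /aff_symbol /aff_v1 /aff_v2 /aff_v3 /= ?v1E ?v2E ?v3E.
Qed.

Lemma aff_filt_sub m n : (m <= n)%N -> {subset aff_filt n <= aff_filt m}.
Proof.
move=> mn g; rewrite /in_mem /= /aff_filt.
move=> /and4P[/implyP h1 /implyP h2 /implyP h3 /implyP h4].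
by apply/and4P; split; apply/implyP => km; have kn := leq_trans km mn; auto.
Qed.

End TruncatedAffineGroup.

(** * Symbols as additive functions on lower central factors *)

Section Symbols.
Local Open Scope ring_scope.
Import GRing.Theory.

Lemma expgz_additive (G : groupType) (V : zmodType) (S : {pred G})
    (phi : G -> V) :
  group_closed S -> {in S &, {morph phi : x z / (x * z)%g >-> x + z}} ->
  forall x n, x \in S -> phi (expgz x n) = phi x *~ n.
Proof.
move=> Sg phiM x n xS.
have phi1 : phi 1%g = 0.
  by apply: (@addrI _ (phi 1%g)); rewrite -phiM ?mulg1 ?addr0 //; case: Sg.
elim/int_rec: n => [|n IH|n IH]; first by rewrite mulr0z.
  by rewrite -addn1 PoszD addrC expgzD phiM ?expgz_closed // IH mulrzDr addrC.
have e : - n%:Z = 1 + - n.+1%:Z by rewrite -addn1 PoszD opprD addrC addrNK.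
apply: (@addrI _ (phi x)); rewrite -phiM ?expgz_closed // -expgzS.
by rewrite [_ + 1]addrC -e IH e mulrzDr mulr1z.
Qed.

Lemma lcs_aff_hom (R : comNzRingType) (G : groupType) (f : hom G (aff R)) n x :
  (n <= 5)%N -> x \in lcs G n -> f x \in @aff_filt R n.
Proof. by move=> n5 xn; apply: lcs_aff => //; exact: hom_lcs. Qed.

(** The symbol is additive on the filtration step n and vanishes on the next one, so it depends
    linearly on the exponents and ignores [z]. *)
Lemma symbol_span (R : comNzRingType) (G : groupType) (f : hom G (aff R)) n
    s1 s2 s3 z p q r : (0 < n < 5)%N -> s1 \in lcs G n -> s2 \in lcs G n ->
    s3 \in lcs G n -> z \in lcs G n.+1 ->
  aff_symbol n (f (expgz s1 p * expgz s2 q * expgz s3 r * z)%g) =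
  aff_symbol n (f s1) *~ p + aff_symbol n (f s2) *~ q
    + aff_symbol n (f s3) *~ r.
Proof.
move=> n5 s1n s2n s3n zn; have [n0 nlt5] := andP n5.
have Fg := @aff_filt_closed R n.
have FM := group_closedM Fg.
have sF s k : s \in lcs G n -> expgz (f s) k \in @aff_filt R n.
  move=> sn; apply: expgz_closed => //.
  by apply: lcs_aff_hom => //; exact: ltnW.
have zF : f z \in @aff_filt R n.+1 by apply: lcs_aff_hom.
have zF' := aff_filt_sub (leqnSn n) zF.
have sE s k :
    s \in lcs G n -> aff_symbol n (expgz (f s) k) = aff_symbol n (f s) *~ k.
  move=> sn; apply: expgz_additive Fg _ _ _ _ => [g h gF hF|].
    exact: aff_symbolM.
  by apply: lcs_aff_hom => //; exact: ltnW.
rewrite !gmulfM !hom_expgz.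
rewrite aff_symbolM ?FM ?sF // (aff_symbol0 n5 zF) addr0.
by rewrite aff_symbolM ?FM ?sF // aff_symbolM ?FM ?sF // !sE.
Qed.

End Symbols.

(** * The two-generator one-relator form of G_K2 *)

Section VirtualKnotGroup.
Local Open Scope group_scope.

Definition K2_word (G : groupType) (a y : G) : G :=
  y * a^-1 * y * a * y^-1 * a * y^-1 * y^-1 * a * y^-1 * a * y * a^-1 * y.

(* The values of y, x_1, ..., x_14 in terms of a = x_2 and y; with these values
   the relation x_7 x_3 = x_3 x_8 says that a commutes with K2_word a y, and
   the other thirteen hold identically. *)
Definition K2_values (G : groupType) (a y : G) : seq G :=
  let x12 := a ^ (y^-1 * a) in
  [:: y; a ^ y; a; a ^ y; a ^ (y * y); a ^ y; a ^ (y * x12);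
      a ^ (y * x12 * y^-1); x12 ^ ((a ^ y)^-1 * y); x12 ^ (a ^ y)^-1;
      x12; x12 ^ y^-1; x12; a ^ y^-1; a].

(** A free group identity, with no relation assumed: the two sides of x_7 x_3 = x_3 x_8 differ by a
    conjugate of [[~ a, K2_word a y]], so this relation is equivalent to the vanishing of that
    commutator. *)
Lemma K2_values_relation (G : groupType) (a y : G) :
  let x := nth 1 (K2_values a y) in
  x 7 * x 3 =
    x 3 * x 8 * [~ a, K2_word a y] ^ (y^-1 * a * y^-1 * a^-1 * y * y).
Proof. by rewrite /= /K2_word /commg /conjg !gnorm. Qed.

Definition K2_gen k : G_K2 := presented_gen K2_relations (inord k).

Section Universal.
Variables (H : groupType) (a y : H).
Hypothesis a_y_rel : [~ a, K2_word a y] = 1.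

Definition K2_value (i : 'I_15) : H := nth 1 (K2_values a y) i.

Lemma K2_value_x k : (k < 15)%N ->
  free_hom K2_value (K2_x k) = nth 1 (K2_values a y) k.
Proof. by move=> k15; rewrite free_hom_gen /K2_value inordK. Qed.

Lemma K2_value_relations :
  {in K2_relations, forall r, free_hom K2_value r.1 = free_hom K2_value r.2}.
Proof.
have yE : free_hom K2_value K2_y = y by exact: (K2_value_x (isT : 0 < 15)%N).
have rel := K2_values_relation a y.
rewrite /= a_y_rel conj1g mulg1 in rel.
move=> r rr; apply/eqP; move: r rr; apply/allP.
rewrite /= !gmulfM !gmulfV yE !K2_value_x //= andbT -{}rel.
by repeat (apply/andP; split); apply/eqP; rewrite /conjg ?gnorm.
Qed.

Definition K2_hom : hom G_K2 H := presented_hom K2_value_relations.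

Lemma K2_hom_gen k : (k < 15)%N ->
  K2_hom (K2_gen k) = nth 1 (K2_values a y) k.
Proof. by move=> k15; rewrite presented_hom_gen /K2_value inordK. Qed.

End Universal.

Definition K2a : G_K2 := K2_gen 2.
Definition K2y : G_K2 := K2_gen 0.

Lemma K2_hom_a (H : groupType) (a y : H) (r : [~ a, K2_word a y] = 1) :
  K2_hom r K2a = a.
Proof. exact: K2_hom_gen. Qed.

Lemma K2_hom_y (H : groupType) (a y : H) (r : [~ a, K2_word a y] = 1) :
  K2_hom r K2y = y.
Proof. exact: K2_hom_gen. Qed.

Lemma K2_gen_relation k : (k < 14)%N ->
  let P := quotient_proj (normal_closure (relators K2_relations)) in
  let r := nth (1, 1) K2_relations k in P r.1 = P r.2.
Proof. by move=> k14 P r; apply: presented_rel; rewrite mem_nth. Qed.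

(** Tietze elimination: thirteen of the relations are used once each to express one further
    generator. The remaining one, at index 2, becomes [K2_relation]. *)
Lemma K2_gen_values k : (k < 15)%N -> K2_gen k = nth 1 (K2_values K2a K2y) k.
Proof.
have E i : quotient_proj (normal_closure (relators K2_relations)) (K2_x i) =
  K2_gen i by [].
have R := K2_gen_relation.
have conjVP (u v z : G_K2) : u = v ^ z -> v = u ^ z^-1.
  by move->; rewrite conjgK.
have mulP (u v z : G_K2) : u * v = v * z -> z = u ^ v.
  by move=> e; rewrite conjgE e mulKg.
(* The argument of [R] is the position of the relation in [K2_relations], counted from 0. *)
have := R 4 isT; rewrite /= gmulfJ !E -/K2a -/K2y => x3.
have := R 9 isT; rewrite /= gmulfJ !E -/K2a -/K2y => x1.
have := R 12 isT; rewrite /= gmulfJ !E -/K2y x1 => /conjVP.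
rewrite conjgK => x14.
have := R 8 isT; rewrite /= gmulfJ !E -/K2y x14 => /conjVP x13.
have := R 10 isT; rewrite /= gmulfJ !E -/K2y x3 => x4.
have := R 7 isT; rewrite /= gmulfJ !E -/K2y x4 => /conjVP; rewrite conjgK => x5.
have := R 1%N isT; rewrite /= !gmulfM !E -/K2a x13 => /esym/mulP.
rewrite -conjgM => x12.
have := R 6 isT; rewrite /= gmulfJ !E -/K2y x12 => /conjVP x11.
have := R 13 isT; rewrite /= gmulfJ !E -/K2y x11 conjgKV => x10.
have := R 0 isT; rewrite /= !gmulfM !E x5 x12 => /mulP; rewrite -conjgM => x6.
have := R 5 isT; rewrite /= gmulfJ !E -/K2y x6 => /conjVP.
rewrite -conjgM => x7.
have := R 3 isT; rewrite /= !gmulfM !E x1 x10 => /mulP/conjVP x9.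
have := R 11 isT; rewrite /= gmulfJ !E -/K2y x9 -conjgM => x8.
have xE := (x1, x3, x4, x5, x6, x7, x8, x9, x10, x11, x12, x13, x14).
by move: k; do 15![case=> [_|]; first by rewrite /= ?xE ?conjgM].
Qed.

Lemma K2_generating_pair : generating_pair K2a K2y.
Proof.
move=> S Sg aS yS q.
have SM := group_closedM Sg; have SV := group_closedV Sg.
have SJ u v : u \in S -> v \in S -> u ^ v \in S.
  by move=> uS vS; rewrite conjgE SM ?SV // SM.
apply: group_closed_generated (presented_generated q) => // z /asboolP[i ->].
have -> : presented_gen K2_relations i = nth 1 (K2_values K2a K2y) i.
  by rewrite -K2_gen_values // /K2_gen inord_val.
have x12S : K2a ^ (K2y^-1 * K2a) \in S by rewrite SJ // SM ?SV.
case: i => k k15; rewrite [nat_of_ord _]/=; move: k k15.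
have y'S := SV _ yS.
do 15![case=> [_|]; first by rewrite /=;
  do ?[exact: yS|exact: aS|exact: x12S|apply: (SJ)|apply: (SM)|apply: (SV)]].
by [].
Qed.

Lemma K2_relation : [~ K2a, K2_word K2a K2y] = 1.
Proof.
have := @K2_gen_relation 2 isT; rewrite /= !gmulfM.
have E i : quotient_proj (normal_closure (relators K2_relations)) (K2_x i) =
  K2_gen i by [].
rewrite !E !K2_gen_values // K2_values_relation -[RHS]mulg1.
by move/mulgI/eqP; rewrite conjg_eq1 => /eqP.
Qed.

End VirtualKnotGroup.

(** * The free group of rank 2 *)

Section FreeGroupRank2.
Local Open Scope group_scope.

Definition F2a : F_ 2 := fgen ord0.
Definition F2y : F_ 2 := fgen ord_max.

Lemma F2_generating_pair : generating_pair F2a F2y.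
Proof.
move=> S Sg aS yS q.
apply: group_closed_generated (free_generated q) => // z /asboolP[i ->].
by case: i => -[|[|//]] i2; [rewrite (_ : Ordinal i2 = ord0)|
  rewrite (_ : Ordinal i2 = ord_max)] => //; exact: val_inj.
Qed.

Definition F2_hom (H : groupType) (a y : H) : hom (F_ 2) H :=
  free_hom (fun i : 'I_2 => if i == ord0 then a else y).

Lemma F2_hom_a (H : groupType) (a y : H) : F2_hom a y F2a = a.
Proof. by rewrite free_hom_gen. Qed.

Lemma F2_hom_y (H : groupType) (a y : H) : F2_hom a y F2y = y.
Proof. by rewrite free_hom_gen. Qed.

End FreeGroupRank2.

(** * Detecting lower central terms by affine representations *)

Section Detection.
Local Open Scope ring_scope.
Import GRing.Theory.

(** The map f |-> (1 + u s) f + v with a constant translation part v. *)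
Definition aff_gen (R : comNzRingType) (u v : R) : aff R :=
  ((u, 0, 0), (v, 0, 0, 0)).

Lemma hom_comm_ay (G H : groupType) (f : hom G H) a y :
  f (comm_ay a y) = comm_ay (f a) (f y).
Proof. exact: gmulfR. Qed.
Lemma hom_comm_aya (G H : groupType) (f : hom G H) a y :
  f (comm_aya a y) = comm_aya (f a) (f y).
Proof. by rewrite /comm_aya gmulfR hom_comm_ay. Qed.
Lemma hom_comm_ayy (G H : groupType) (f : hom G H) a y :
  f (comm_ayy a y) = comm_ayy (f a) (f y).
Proof. by rewrite /comm_ayy gmulfR hom_comm_ay. Qed.
Lemma hom_comm_ayaa (G H : groupType) (f : hom G H) a y :
  f (comm_ayaa a y) = comm_ayaa (f a) (f y).
Proof. by rewrite /comm_ayaa gmulfR hom_comm_aya. Qed.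
Lemma hom_comm_ayay (G H : groupType) (f : hom G H) a y :
  f (comm_ayay a y) = comm_ayay (f a) (f y).
Proof. by rewrite /comm_ayay gmulfR hom_comm_aya. Qed.
Lemma hom_comm_ayyy (G H : groupType) (f : hom G H) a y :
  f (comm_ayyy a y) = comm_ayyy (f a) (f y).
Proof. by rewrite /comm_ayyy gmulfR hom_comm_ayy. Qed.
Lemma hom_K2_word (G H : groupType) (f : hom G H) a y :
  f (K2_word a y) = K2_word (f a) (f y).
Proof. by rewrite /K2_word !gmulfM !gmulfV. Qed.

Definition hom_comm := (hom_comm_ayaa, hom_comm_ayay, hom_comm_ayyy,
  hom_comm_aya, hom_comm_ayy, hom_comm_ay, hom_K2_word).

(** Stated over any [R] because this representation is needed over the integers for the free group,
    but over the integers modulo 4 for the knot group. *)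
Lemma symbol4A (R : comNzRingType) (G : groupType) (a y : G)
    (fA : hom G (aff R)) p q r z :
  fA a = aff_gen 1 0 -> fA y = aff_gen 0 1 -> z \in lcs G 5 ->
  aff_symbol 4 (fA (expgz (comm_ayaa a y) p * expgz (comm_ayay a y) q
    * expgz (comm_ayyy a y) r * z)%g) = p%:~R.
Proof.
move=> fAa fAy zn.
rewrite symbol_span ?comm_ayaa_lcs ?comm_ayay_lcs ?comm_ayyy_lcs //.
rewrite !hom_comm fAa fAy.
have -> : aff_symbol 4 (comm_ayaa (aff_gen (1 : R) 0) (aff_gen 0 1)) = 1.
  by rewrite /= /aff_v3 /=; ring.
have -> : aff_symbol 4 (comm_ayay (aff_gen (1 : R) 0) (aff_gen 0 1)) = 0.
  by rewrite /= /aff_v3 /=; ring.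
have e3 : aff_symbol 4 (comm_ayyy (aff_gen (1 : R) 0) (aff_gen 0 1)) = 0.
  by rewrite /= /aff_v3 /=; ring.
by rewrite ?e3 !mul0rz !addr0.
Qed.

(* On an element with coordinates (n1, n2, n3) with respect to the spanning
   family comm_ayaa, comm_ayay, comm_ayyy of lcs 4 modulo lcs 5, the symbols of
   these three representations are n1, n1 + n2 + n3 and - n3. *)
Section Detect.
Variables (G : groupType) (a y : G).
Hypothesis gen_ay : generating_pair a y.
Variables fA fB fC : hom G (aff int).
Hypotheses (fAa : fA a = aff_gen 1 0) (fAy : fA y = aff_gen 0 1).
Hypotheses (fBa : fB a = aff_gen 1 0) (fBy : fB y = aff_gen 1 1).
Hypotheses (fCa : fC a = aff_gen 0 1) (fCy : fC y = aff_gen 1 0).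

Let one_lcs k : 1%g \in lcs G k. Proof. exact: gpred1. Qed.

(** The two symbols are the exponents of [a] and [y] in [x]; once they vanish, only the factor from
    [lcs G 2] remains. *)
Lemma lcs_detect1 x :
  aff_symbol 1 (fA x) = 0 -> aff_symbol 1 (fC x) = 0 -> x \in lcs G 2.
Proof.
have /asboolP[p [q [r [z zn ->]]]] := lcs_span1 gen_ay (isT : x \in lcs G 1).
have S f := @symbol_span _ _ f 1 a y 1%g z p q r isT isT isT isT zn.
rewrite !S fAa fAy fCa fCy !gmulf1 !mulrzz /aff_symbol /aff_u1 /= => pE qE.
have -> : p = 0 by lia.
have -> : q = 0 by lia.
by rewrite expg1z !mul1g.
Qed.

Lemma lcs_detect2 x :
  x \in lcs G 2 -> aff_symbol 2 (fA x) = 0 -> x \in lcs G 3.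
Proof.
move=> /(lcs_span2 gen_ay)/asboolP[p [q [r [z zn ->]]]].
rewrite symbol_span ?comm_ay_lcs // !hom_comm !gmulf1 fAa fAy.
have -> : aff_symbol 2 (comm_ay (aff_gen (1 : int) 0) (aff_gen 0 1)) = 1 by [].
rewrite !mulrzz /aff_symbol /aff_v1 /= => pE.
have -> : p = 0 by lia.
by rewrite !expg1z !mul1g.
Qed.

(** If [x] has exponents p and q on [comm_aya] and [comm_ayy], the symbols are - p and - p - q. *)
Lemma lcs_detect3 x : x \in lcs G 3 ->
  aff_symbol 3 (fA x) = 0 -> aff_symbol 3 (fB x) = 0 -> x \in lcs G 4.
Proof.
move=> /(lcs_span3 gen_ay)/asboolP[p [q [r [z zn ->]]]].
have S f := @symbol_span _ _ f 3 (comm_aya a y) (comm_ayy a y) 1%g z p q r isT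
  (comm_aya_lcs a y) (comm_ayy_lcs a y) (one_lcs 3) zn.
rewrite !S !hom_comm !gmulf1 fAa fAy fBa fBy.
have -> : aff_symbol 3 (comm_aya
    (aff_gen (1 : int) 0) (aff_gen 0 1)) = -1 by [].
have -> : aff_symbol 3 (comm_ayy (aff_gen (1 : int) 0) (aff_gen 0 1)) = 0 by [].
have -> : aff_symbol 3 (comm_aya
    (aff_gen (1 : int) 0) (aff_gen 1 1)) = -1 by [].
have e : aff_symbol 3 (comm_ayy (aff_gen (1 : int) 0) (aff_gen 1 1)) = -1 by [].
rewrite ?e !mulrzz /aff_symbol /aff_v2 /= => pE qE.
have -> : p = 0 by lia.
have -> : q = 0 by lia.
by rewrite !expg1z !mul1g.
Qed.

Lemma symbol4B p q r z : z \in lcs G 5 ->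
  aff_symbol 4 (fB (expgz (comm_ayaa a y) p * expgz (comm_ayay a y) q
    * expgz (comm_ayyy a y) r * z)%g) = p + q + r.
Proof.
move=> zn; rewrite symbol_span ?comm_ayaa_lcs ?comm_ayay_lcs ?comm_ayyy_lcs //.
rewrite !hom_comm fBa fBy.
have -> : aff_symbol 4 (comm_ayaa
    (aff_gen (1 : int) 0) (aff_gen 1 1)) = 1 by [].
have e2 : aff_symbol 4 (comm_ayay
    (aff_gen (1 : int) 0) (aff_gen 1 1)) = 1 by [].
have e3 : aff_symbol 4 (comm_ayyy
    (aff_gen (1 : int) 0) (aff_gen 1 1)) = 1 by [].
by rewrite ?e2 ?e3 !mulrzz !mul1r.
Qed.

Lemma symbol4C p q r z : z \in lcs G 5 ->
  aff_symbol 4 (fC (expgz (comm_ayaa a y) p * expgz (comm_ayay a y) q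
    * expgz (comm_ayyy a y) r * z)%g) = - r.
Proof.
move=> zn; rewrite symbol_span ?comm_ayaa_lcs ?comm_ayay_lcs ?comm_ayyy_lcs //.
rewrite !hom_comm fCa fCy.
have -> : aff_symbol 4 (comm_ayaa
    (aff_gen (0 : int) 1) (aff_gen 1 0)) = 0 by [].
have e2 : aff_symbol 4 (comm_ayay
    (aff_gen (0 : int) 1) (aff_gen 1 0)) = 0 by [].
have -> : aff_symbol 4 (comm_ayyy
    (aff_gen (0 : int) 1) (aff_gen 1 0)) = -1 by [].
by rewrite ?e2 !mulrzz !mul0r !add0r mulN1r.
Qed.

Lemma lcs_detect4 x : x \in lcs G 4 -> aff_symbol 4 (fA x) = 0 ->
  aff_symbol 4 (fB x) = 0 -> aff_symbol 4 (fC x) = 0 -> x \in lcs G 5.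
Proof.
move=> /(lcs_span4 gen_ay)/asboolP[p [q [r [z zn ->]]]].
rewrite symbol4A // symbol4B // symbol4C // intz => pE qE rE.
have -> : p = 0 by [].
have -> : q = 0 by lia.
have -> : r = 0 by lia.
by rewrite !mul1g.
Qed.

End Detect.

End Detection.

(** * Lower central quotients *)

Section LowerCentralQuotients.
Local Open Scope group_scope.

Definition F2_repA := F2_hom (aff_gen (1 : int) 0) (aff_gen 0 1)%R.
Definition F2_repB := F2_hom (aff_gen (1 : int) 0) (aff_gen 1 1)%R.
Definition F2_repC := F2_hom (aff_gen (0 : int) 1) (aff_gen 1 0)%R.

Lemma F2_lcs_detect4 x : x \in lcs (F_ 2) 4 -> aff_symbol 4 (F2_repA x) = 0%R ->
  aff_symbol 4 (F2_repB x) = 0%R -> aff_symbol 4 (F2_repC x) = 0%R ->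
  x \in lcs (F_ 2) 5.
Proof.
by apply: (lcs_detect4 F2_generating_pair); rewrite ?F2_hom_a ?F2_hom_y.
Qed.

Definition F2_relator := [~ F2a, K2_word F2a F2y].

(** Evaluation shows that the relator is trivial under the second and third representations and is
    the translation by 4 s^3 under the first, so all symbols of degree at most 3 vanish. *)
Lemma F2_relator_lcs4 : F2_relator \in lcs (F_ 2) 4.
Proof.
have EA : F2_repA F2_relator = ((0, 0, 0), (0, 0, 0, 4))%R.
  by rewrite /F2_relator gmulfR hom_K2_word F2_hom_a F2_hom_y.
have EB : F2_repB F2_relator = 1.
  by rewrite /F2_relator gmulfR hom_K2_word F2_hom_a F2_hom_y.
have EC : F2_repC F2_relator = 1.
  by rewrite /F2_relator gmulfR hom_K2_word F2_hom_a F2_hom_y.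
apply: (@lcs_detect3 _ _ _ F2_generating_pair F2_repA F2_repB);
  rewrite ?F2_hom_a ?F2_hom_y ?EA ?EB //.
apply: (@lcs_detect2 _ _ _ F2_generating_pair F2_repA);
  rewrite ?F2_hom_a ?F2_hom_y ?EA //.
by apply: (@lcs_detect1 _ _ _ F2_generating_pair F2_repA F2_repC);
  rewrite ?F2_hom_a ?F2_hom_y ?EA ?EC.
Qed.

(** The fourth symbols 4, 0, 0 of the relator force its coordinates to be (4, -4, 0); the two powers
    cancel them. *)
Lemma F2_relator_mod_lcs5 :
  expgz (comm_ayaa F2a F2y) (- 4%:Z) * expgz (comm_ayay F2a F2y) 4
    * F2_relator \in lcs (F_ 2) 5.
Proof.
apply: F2_lcs_detect4.
- apply: gpredM F2_relator_lcs4.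
  by apply: gpredM; apply: expgz_closed (lcs_closed _ _) _;
    [exact: comm_ayaa_lcs|exact: comm_ayay_lcs].
- by rewrite 2!gmulfM !hom_expgz !hom_comm F2_hom_a F2_hom_y.
- by rewrite 2!gmulfM !hom_expgz !hom_comm F2_hom_a F2_hom_y.
- by rewrite 2!gmulfM !hom_expgz !hom_comm F2_hom_a F2_hom_y.
Qed.

Definition F2_to_K2 : hom (F_ 2) G_K2 := F2_hom K2a K2y.

Lemma K2_torsion :
  expgz (comm_ayaa K2a K2y) (- 4%:Z) * expgz (comm_ayay K2a K2y) 4
    \in lcs G_K2 5.
Proof.
have := hom_lcs F2_to_K2 F2_relator_mod_lcs5.
rewrite 2!gmulfM !hom_expgz !hom_comm F2_hom_a F2_hom_y.
by rewrite /comm_ay K2_relation mulg1.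
Qed.

Lemma aff_relB : let a := aff_gen (1 : int) 0%R in
  [~ a, K2_word a (aff_gen 1 1)%R] = 1.
Proof. by []. Qed.
Lemma aff_relC : let a := aff_gen (0 : int) 1%R in
  [~ a, K2_word a (aff_gen 1 0)%R] = 1.
Proof. by []. Qed.
(** Over the integers this commutator is the translation by 4 s^3, so coefficients are taken modulo
    4. *)
Lemma aff_relA4 : let a := aff_gen (1 : 'Z_4) 0%R in
  [~ a, K2_word a (aff_gen 0 1)%R] = 1.
Proof. by apply/eqP. Qed.

Definition K2_repA := K2_hom aff_relA4.
Definition K2_repB := K2_hom aff_relB.
Definition K2_repC := K2_hom aff_relC.

Lemma K2_symbols4 p q r z : z \in lcs G_K2 5 ->
  let x := expgz (comm_ayaa K2a K2y) p * expgz (comm_ayay K2a K2y) q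
    * expgz (comm_ayyy K2a K2y) r * z in
  [/\ aff_symbol 4 (K2_repA x) = p%:~R%R,
      aff_symbol 4 (K2_repB x) = (p + q + r)%R
    & aff_symbol 4 (K2_repC x) = (- r)%R].
Proof.
move=> zn x; split; first by apply: symbol4A; rewrite ?K2_hom_a ?K2_hom_y.
  by apply: symbol4B; rewrite ?K2_hom_a ?K2_hom_y.
by apply: symbol4C; rewrite ?K2_hom_a ?K2_hom_y.
Qed.

Local Notation lcs45 := (within (lcs G_K2 4) (lcs G_K2 5)).

(** An element with coordinates (p, q, r) is sent to (p + q + r, - r, p modulo 4). *)
Definition K2_symbol (x : subgroup (lcs G_K2 4)) : (Zinf * Zinf * Z4)%type :=
  (aff_symbol 4 (K2_repB (val x)), aff_symbol 4 (K2_repC (val x)),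
   aff_symbol 4 (K2_repA (val x))).

Lemma K2_symbolM : {morph K2_symbol : x z / x * z}.
Proof.
move=> x z.
have sM (R : comNzRingType) (f : hom G_K2 (aff R)) :
    aff_symbol 4 (f (val (x * z))) =
    (aff_symbol 4 (f (val x)) + aff_symbol 4 (f (val z)))%R.
  have fF (u : subgroup (lcs G_K2 4)) : f (val u) \in @aff_filt R 4.
    by apply: lcs_aff_hom => //; exact: (valP u).
  by rewrite valM gmulfM; apply: aff_symbolM => //; exact: fF.
by rewrite /K2_symbol !sM.
Qed.

Lemma intr_Z4_eq0 (p : int) : (p%:~R = 0 :> 'Z_4)%R -> exists m, p = (m * 4)%R.
Proof.
have four0 : (4%:~R = 0 :> 'Z_4)%R by apply/eqP.
rewrite (divz_eq p 4) intrD intrM four0 GRing.mulr0 GRing.add0r => pE.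
exists (divz p 4); suff -> : modz p 4 = 0%R by rewrite GRing.addr0.
have : (0 <= modz p 4 < 4)%R by rewrite modz_ge0 //= ltz_pmod.
by case: (modz p 4) pE => [[|[|[|[|m]]]]|m] // /eqP.
Qed.

Lemma K2_symbol_ker x : (K2_symbol x == 1) = (x \in lcs45).
Proof.
apply/eqP/idP => [|xn].
  have /(lcs_span4 K2_generating_pair)/asboolP[p [q [r [z zn xE]]]] := valP x.
  have [EA EB EC] := K2_symbols4 p q r zn.
  rewrite /K2_symbol xE EA EB EC => -[qE rE /intr_Z4_eq0[m mE]].
  (* The unit of [Zinf] is the integer 0 by conversion. *)
  have {}qE : (p + q + r = 0)%R := qE; have {}rE : (- r = 0)%R := rE.
  have r0 : r = 0%R by lia.
  have q0 : q = (- m * 4)%R by lia.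
  have -> : (x \in lcs45) = (val x \in lcs G_K2 5) by [].
  (* What is left is an m-th power of [comm_ayaa] to the 4 times the inverse of an m-th power of
     [comm_ayay] to the 4; the two bases agree modulo [lcs G_K2 5] by [K2_torsion]. *)
  rewrite xE mE q0 r0 !expgzM mulg1 expgzN gpredMr // -quotient_proj_eq1.
  rewrite gmulfM gmulfV !hom_expgz; apply/eqP/(canLR (mulgK _)); rewrite mul1g.
  by congr (expgz _ m); rewrite -!hom_expgz; apply/quotient_projP/K2_torsion.
have {}xn : val x \in lcs G_K2 5 by [].
have s0 (R : comNzRingType) (f : hom G_K2 (aff R)) :
    aff_symbol 4 (f (val x)) = 0%R.
  by apply: aff_symbol0 => //; apply: lcs_aff_hom.
by rewrite /K2_symbol !s0.
Qed.

Lemma K2_symbol_surj h : exists x, K2_symbol x = h.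
Proof.
case: h => [[i j] k]; pose i' : int := i; pose j' : int := j.
pose k' := Posz (val (k : 'Z_4)).
(* The exponents solve p + q + r = i', - r = j' and p = k'. *)
pose x := expgz (comm_ayaa K2a K2y) k'
    * expgz (comm_ayay K2a K2y) (i' - k' + j')%R
    * expgz (comm_ayyy K2a K2y) (- j')%R * 1.
have xn : x \in lcs G_K2 4.
  have L := lcs_closed G_K2 4; rewrite /x mulg1.
  apply: gpredM; last exact/(expgz_closed _ L)/comm_ayyy_lcs.
  by apply: gpredM; apply: (expgz_closed _ L);
    [exact: comm_ayaa_lcs|exact: comm_ayay_lcs].
exists (exist _ x xn); rewrite /K2_symbol -[val _]/x.
have [EA EB EC] := K2_symbols4 k' (i' - k' + j')%R (- j')%R (lcs_one G_K2 5).
rewrite -/x in EA EB EC; rewrite EA EB EC.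
congr (_, _, _).
- suff : (k' + (i' - k' + j') + - j')%R = i' by []; lia.
- exact: GRing.opprK.
- exact: natr_Zp.
Qed.

Lemma K2_lcs4_lcs5 :
  isomorphic (quotient_group lcs45) (Zinf * Zinf * Z4)%type.
Proof.
apply: (@first_isomorphism _ _ _ (hom_of K2_symbolM)) => [x|h].
  by rewrite hom_ofE K2_symbol_ker.
by have [x <-] := K2_symbol_surj h; exists x; rewrite hom_ofE.
Qed.

Lemma K2_comm_ayaa_notin_lcs5 m : (~ exists n : int, m = n * 4)%R ->
  expgz (comm_ayaa K2a K2y) m \notin lcs G_K2 5.
Proof.
move=> m4; apply/negP => em.
have [EA _ _] := K2_symbols4 m 0 0 (lcs_one G_K2 5).
apply/m4/intr_Z4_eq0; rewrite -EA !mulg1.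
by apply: aff_symbol0 => //; apply: lcs_aff_hom.
Qed.

(** An equality between two of the terms makes the series stationary from the smaller index on, so
    the fourth and fifth terms would agree; but [comm_ayaa] lies in the fourth and not in the
    fifth. *)
Lemma K2_lcs_distinct i j : (1 <= i <= 5)%N -> (1 <= j <= 5)%N -> i <> j ->
  ~ (lcs G_K2 i =i lcs G_K2 j).
Proof.
wlog ij : i j / (i < j)%N.
  move=> H hi hj nij; case: (ltngtP i j) => // [ij|ji]; first exact: H.
  by move=> e; apply: (H j i) => // /esym.
case: i ij => // i ij _ /andP[_ j5] _ e.
have st : lcs G_K2 i.+1 =i lcs G_K2 i.+2.
  move=> x; apply/idP/idP; last exact: lcsS_sub.
  by rewrite e; exact: lcs_sub.
have stable k : lcs G_K2 (i + k).+1 =i lcs G_K2 (i + k).+2.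
  by elim: k => [|k IH]; rewrite ?addn0 // addnS; exact: lcs_stable.
(* Now [i] is one less than the original index, and this choice yields the equality of [lcs G_K2 4]
   and [lcs G_K2 5]. *)
have := stable (3 - i); rewrite subnKC ?(leq_trans ij j5) //; last by lia.
move=> st4; have e1 := comm_ayaa_lcs K2a K2y; rewrite st4 in e1.
have nd : ~ exists n : int, 1%R = (n * 4)%R by case=> n; lia.
by have /negP := K2_comm_ayaa_notin_lcs5 nd.
Qed.

(** The relator lies in [lcs (F_ 2) 4], so the projection of the free group modulo that term factors
    through [G_K2], and the factor kills [lcs G_K2 4]. *)
Lemma F2_to_K2_lcs4 x : (F2_to_K2 x \in lcs G_K2 4) = (x \in lcs (F_ 2) 4).
Proof.
apply/idP/idP => [xn|]; last exact: hom_lcs.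
pose P := quotient_proj (lcs (F_ 2) 4).
have rel : [~ P F2a, K2_word (P F2a) (P F2y)] = 1.
  rewrite -hom_K2_word -gmulfR; apply/eqP; rewrite quotient_proj_eq1.
  exact: F2_relator_lcs4.
have PE : hom_comp (K2_hom rel) F2_to_K2 =1 P.
  apply: generating_pair_hom_eq F2_generating_pair _ _; rewrite hom_compE.
    by rewrite F2_hom_a K2_hom_a.
  by rewrite F2_hom_y K2_hom_y.
rewrite -quotient_proj_eq1 -/P -PE hom_compE; apply/eqP/lcs_quotient_lcs.
exact: hom_lcs.
Qed.

(** The composite of [F2_to_K2] with the projection has kernel [lcs (F_ 2) 4]; it is onto because
    the image of [F2_to_K2] is a subgroup containing the generating pair. *)
Lemma K2_mod_lcs4 : isomorphic (quotient_group (lcs G_K2 4))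
  (quotient_group (lcs (F_ 2) 4)).
Proof.
apply: isomorphic_sym; pose P := quotient_proj (lcs G_K2 4).
apply: (@first_isomorphism _ _ _ (hom_comp P F2_to_K2)) => [x|q].
  by rewrite hom_compE quotient_proj_eq1 F2_to_K2_lcs4.
suff [x xE] : exists x, F2_to_K2 x = repr q.
  by exists x; rewrite hom_compE xE quotient_proj_repr.
pose S : {pred G_K2} := fun z => `[< exists x, F2_to_K2 x = z >].
suff /asboolP : repr q \in S by [].
apply: K2_generating_pair.
- split; first by apply/asboolP; exists 1; rewrite gmulf1.
  move=> _ _ /asboolP[x <-] /asboolP[z <-].
  by apply/asboolP; exists (x / z); rewrite gmulfF.
- by apply/asboolP; exists F2a; rewrite F2_hom_a.
- by apply/asboolP; exists F2y; rewrite F2_hom_y.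
Qed.

(** Integral symbols of [x] to the 4 are four times those of [x], and the symbols detect
    [lcs (F_ 2) 5]. *)
Lemma F2_lcs5_torsionfree x :
  x \in lcs (F_ 2) 4 -> expgz x 4 \in lcs (F_ 2) 5 -> x \in lcs (F_ 2) 5.
Proof.
move=> x4 x5.
have s0 (f : hom (F_ 2) (aff int)) : aff_symbol 4 (f x) = 0%R.
  have fF : f x \in @aff_filt int 4 by apply: lcs_aff_hom.
  have : aff_symbol 4 (f (expgz x 4)) = 0%R.
    by apply: aff_symbol0 => //; apply: lcs_aff_hom.
  rewrite hom_expgz (expgz_additive (aff_filt_closed int 4)) //.
    by move/eqP; rewrite mulrz_eq0 => /orP[|/eqP].
  by move=> g h gF hF; apply: aff_symbolM.
by apply: F2_lcs_detect4.
Qed.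

(** An isomorphism would carry the class of [e] to that of some [x] in [lcs (F_ 2) 4] whose fourth
    power is in [lcs (F_ 2) 5]. Then [x], and so [e], would be trivial modulo the fifth term,
    although the symbol of [e] modulo 4 is 1. *)
Lemma K2_mod_lcs5 : ~ isomorphic (quotient_group (lcs G_K2 5))
  (quotient_group (lcs (F_ 2) 5)).
Proof.
case=> f0 fM [g fK gK]; pose f := hom_of fM.
pose P := quotient_proj (lcs G_K2 5); pose Q := quotient_proj (lcs (F_ 2) 5).
pose e := comm_ayaa K2a K2y * (comm_ayay K2a K2y)^-1.
have e4 : e \in lcs G_K2 4.
  apply: gpredM; rewrite ?gpredV; first exact: comm_ayaa_lcs.
  exact: comm_ayay_lcs.
have e5 : expgz e 4 \in lcs G_K2 5.
  have T : P (comm_ayaa K2a K2y) ^+ 4 = P (comm_ayay K2a K2y) ^+ 4.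
    by rewrite -!gmulfXn; apply/quotient_projP; exact: K2_torsion.
  have com : commute (P (comm_ayaa K2a K2y)) (P (comm_ayay K2a K2y))^-1.
    by apply/commuteV/lcs_central/comm_ayay_lcs.
  rewrite -quotient_proj_eq1 hom_expgz /e gmulfM gmulfV /= expgMn //.
  by rewrite expVgn -T mulgV.
have [x x4 fx] := lcs_quotient (hom_lcs f (hom_lcs P e4)).
have x5 : x \in lcs (F_ 2) 5.
  apply: (F2_lcs5_torsionfree x4).
  rewrite -quotient_proj_eq1 hom_expgz -/Q -fx -hom_expgz -hom_expgz.
  by move: e5; rewrite -quotient_proj_eq1 => /eqP ->; rewrite gmulf1.
have e5' : e \in lcs G_K2 5.
  rewrite -quotient_proj_eq1 -/P -(fK (P e)) -(fK 1) -[f0 _](hom_ofE fM) -/f.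
  rewrite -[f0 1](hom_ofE fM) -/f fx gmulf1 (_ : Q x = 1) //.
  by apply/eqP; rewrite quotient_proj_eq1.
have [EA _ _] := K2_symbols4 1 (-1) 0 (lcs_one G_K2 5).
have : aff_symbol 4 (K2_repA e) = 0%R.
  by apply: aff_symbol0 => //; apply: lcs_aff_hom.
by rewrite !mulg1 in EA; rewrite EA.
Qed.
End LowerCentralQuotients.

(** * Free-by-cyclic structure *)

Section MappingTorus.
Local Open Scope group_scope.
Variables (K : groupType) (phi psi : hom K K).
Hypotheses (phiK : cancel phi psi) (psiK : cancel psi phi).

Definition autz (n : int) (x : K) : K :=
  match n with Posz m => iter m phi x | Negz m => iter m.+1 psi x end.

Lemma autzM n : {morph autz n : x z / x * z}.
Proof.
have iterM (f : hom K K) m : {morph iter m f : x z / x * z}.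
  by elim: m => // m IH x z; rewrite !iterS IH gmulfM.
by case: n => m x z; rewrite /autz iterM.
Qed.

Lemma autzS n x : autz (n + 1)%R x = phi (autz n x).
Proof.
case: n => [m|[|m]]; first by rewrite -PoszD addn1.
  by rewrite /= psiK.
have -> : (Negz m.+1 + 1 = Negz m)%R by lia.
by rewrite /= psiK.
Qed.

Lemma autzD m n x : autz (m + n)%R x = autz m (autz n x).
Proof.
elim/int_rec: m => [|m IH|m IH]; first by rewrite GRing.add0r.
  by rewrite -addn1 PoszD (GRing.addrAC _ 1%R) !autzS IH.
apply: (can_inj phiK); rewrite -!autzS.
have -> : (- m.+1%:Z + n + 1 = - m%:Z + n)%R by lia.
by have -> : (- m.+1%:Z + 1 = - m%:Z)%R by lia.
Qed.

Lemma autz1 n : autz n 1 = 1.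
Proof. by apply: (mulgI (autz n 1)); rewrite -autzM !mulg1. Qed.

(** The pair (x, n) stands for x a^n in the semidirect product in which a x a^-1 = [phi] x. The
    cancellation proofs are arguments because the group law depends on them. *)
Definition mapping_torus (fK : cancel phi psi) (gK : cancel psi phi) : Type :=
  (K * int)%type.
Local Notation T := (mapping_torus phiK psiK).

HB.instance Definition _ := Choice.on T.

Definition torus_mul (u v : T) : T := (u.1 * autz u.2 v.1, (u.2 + v.2)%R).
Definition torus_one : T := (1, 0%R).
Definition torus_inv (u : T) : T := (autz (- u.2)%R u.1^-1, (- u.2)%R).

Lemma torus_mulA : associative torus_mul.
Proof.
move=> u v w; congr (_, _); last by rewrite /= GRing.addrA.
by rewrite /= autzM autzD mulgA.
Qed.
Lemma torus_mul1g : left_id torus_one torus_mul.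
Proof. by case=> x n; rewrite /torus_mul /= mul1g GRing.add0r. Qed.
Lemma torus_mulVg : left_inverse torus_one torus_inv torus_mul.
Proof. by case=> x n; rewrite /torus_mul /= -autzM mulVg autz1 GRing.addNr. Qed.
Lemma torus_mulg1 : right_id torus_one torus_mul.
Proof.
by case=> x n; rewrite /torus_mul /= GRing.addr0 autz1 mulg1.
Qed.
Lemma torus_mulgV : right_inverse torus_one torus_inv torus_mul.
Proof.
case=> x n; rewrite /torus_mul /= -autzD GRing.subrr /=.
by rewrite mulgV.
Qed.

HB.instance Definition _ := isGroup.Build T
  torus_mulA torus_mul1g torus_mulg1 torus_mulVg torus_mulgV.

Lemma torus_base_subproof : {morph (fun x : K => (x, 0%R) : T) : x z / x * z}.
Proof. by []. Qed.

Definition torus_base : hom K T := hom_of torus_base_subproof.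

Lemma torus_baseE x : torus_base x = (x, 0%R).
Proof. by rewrite hom_ofE. Qed.

Definition torus_shift : T := (1, 1%R).

Lemma torus_base_shift x :
  torus_base (phi x) = torus_base x ^ torus_shift^-1.
Proof.
rewrite conjgE invgK !hom_ofE.
have -> : torus_shift * (((x, 0%R) : T) * torus_shift^-1) =
    (phi x, 0%R) :> T; last by [].
by congr (_, _); rewrite /= mul1g invg1 gmulf1 mulg1.
Qed.

Lemma torus_base_inj : injective torus_base.
Proof. by move=> x z; rewrite !hom_ofE => -[]. Qed.

Lemma torus_exponent_subproof :
  {morph (fun u : T => u.2 : Zinf) : u v / u * v}.
Proof. by []. Qed.

Definition torus_exponent : hom T Zinf := hom_of torus_exponent_subproof.

Lemma torus_exponentE u : torus_exponent u = u.2.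
Proof. by rewrite hom_ofE. Qed.

Section TorusHom.
Variables (G : groupType) (theta : hom K G) (a : G).
Hypothesis theta_phi : forall x, theta (phi x) = theta x ^ a^-1.

Lemma hom_autz n x : theta (autz n x) = theta x ^ (expgz a n)^-1.
Proof.
elim/int_rec: n x => [|n IH|n IH] x; first by rewrite /= invg1 conjg1.
  by rewrite -addn1 PoszD autzS theta_phi IH GRing.addrC expgzD invgM conjgM.
have step z : theta (psi z) = theta z ^ a.
  by rewrite -{2}(psiK z) theta_phi conjgKV.
have -> : (- n.+1%:Z = - n%:Z + -1)%R by lia.
by rewrite autzD IH step -conjgM expgzD invgM /= invgK.
Qed.

(** Universal property of the semidirect product: [theta] and [a] extend together because
    conjugation by [a^-1] realizes [phi] on the image of [theta]. *)
Lemma torus_hom_subproof :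
  {morph (fun u : T => theta u.1 * expgz a u.2) : u v / u * v}.
Proof.
move=> u v; rewrite /= gmulfM hom_autz expgzD conjgE invgK !mulgA.
by rewrite mulgVK.
Qed.

Definition torus_hom : hom T G := hom_of torus_hom_subproof.

Lemma torus_homE u : torus_hom u = theta u.1 * expgz a u.2.
Proof. by rewrite hom_ofE. Qed.

End TorusHom.
End MappingTorus.

(** * The knot group as a semidirect product of a free group of rank 5 with the integers *)

Section FreeByCyclic.
Local Open Scope group_scope.

(* With y_k = a^k y a^-k, the relation [a, K2_word a y] = 1 is equivalent to
   y_5 = torus_word y_0 ... y_4, and y_0 can be solved for in it. *)
Definition torus_word (G : groupType) (y0 y1 y2 y3 y4 : G) : G :=
  y4 * y3 * y3 * y2 * y1^-1 * y2^-1 * y1 * y0 * y1^-1 * y2^-1 * y2^-1 * y3^-1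
  * y4 * y3 * y4^-1.

(** The solution for y_0 of the equation y_5 = [torus_word] y_0 ... y_4. *)
Definition torus_coword (G : groupType) (y1 y2 y3 y4 y5 : G) : G :=
  (y4 * y3 * y3 * y2 * y1^-1 * y2^-1 * y1)^-1 * y5
  * (y1^-1 * y2^-1 * y2^-1 * y3^-1 * y4 * y3 * y4^-1)^-1.

(** A free group identity: the equation for y_5 fails by a conjugate of the relator. Conjugating by
    the k-th power of [a^-1] gives a^k y a^-k. *)
Lemma torus_wordE (G : groupType) (a y : G) :
  let y_ (k : nat) := y ^ (a^-1 ^+ k) in
  y_ 5 = torus_word (y_ 0) (y_ 1%N) (y_ 2) (y_ 3) (y_ 4)
    * [~ a, K2_word a y] ^ (y^-1 * a^-1 ^+ 4).
Proof.
by rewrite /= /torus_word /K2_word !expgS expg0 /commg /conjg !gnorm.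
Qed.

Lemma hom_torus_word (G H : groupType) (f : hom G H) y0 y1 y2 y3 y4 :
  f (torus_word y0 y1 y2 y3 y4) = torus_word (f y0) (f y1) (f y2) (f y3) (f y4).
Proof. by rewrite /torus_word !gmulfM !gmulfV. Qed.

Lemma hom_torus_coword (G H : groupType) (f : hom G H) y1 y2 y3 y4 y5 :
  f (torus_coword y1 y2 y3 y4 y5) =
  torus_coword (f y1) (f y2) (f y3) (f y4) (f y5).
Proof. by rewrite /torus_coword !gmulfM !gmulfV !gmulfM !gmulfV. Qed.

Definition F5_gen (k : nat) : F_ 5 := fgen (inord k).

Definition F5_phi : hom (F_ 5) (F_ 5) := free_hom (fun i : 'I_5 =>
  nth 1 [:: F5_gen 1; F5_gen 2; F5_gen 3; F5_gen 4;
    torus_word (F5_gen 0) (F5_gen 1) (F5_gen 2) (F5_gen 3) (F5_gen 4)] i).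

(** The backward shift: the coword, with all indices lowered by one, gives y_(-1) in terms of y_0,
    ..., y_4. *)
Definition F5_psi : hom (F_ 5) (F_ 5) := free_hom (fun i : 'I_5 =>
  nth 1 [:: torus_coword (F5_gen 0) (F5_gen 1) (F5_gen 2) (F5_gen 3) (F5_gen 4);
    F5_gen 0; F5_gen 1; F5_gen 2; F5_gen 3] i).

Lemma F5_hom_eq (H : groupType) (f g : hom (F_ 5) H) :
  (forall k, (k < 5)%N -> f (F5_gen k) = g (F5_gen k)) -> f =1 g.
Proof.
move=> fg; apply: free_hom_eq => i.
by have := fg i (ltn_ord i); rewrite /F5_gen inord_val.
Qed.

Lemma F5_phiE k : (k < 5)%N -> F5_phi (F5_gen k) =
  nth 1 [:: F5_gen 1; F5_gen 2; F5_gen 3; F5_gen 4;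
    torus_word (F5_gen 0) (F5_gen 1) (F5_gen 2) (F5_gen 3) (F5_gen 4)] k.
Proof. by move=> k5; rewrite free_hom_gen inordK. Qed.

Lemma F5_psiE k : (k < 5)%N -> F5_psi (F5_gen k) =
  nth 1 [:: torus_coword (F5_gen 0) (F5_gen 1) (F5_gen 2) (F5_gen 3) (F5_gen 4);
    F5_gen 0; F5_gen 1; F5_gen 2; F5_gen 3] k.
Proof. by move=> k5; rewrite free_hom_gen inordK. Qed.

Lemma F5_phiK : cancel F5_phi F5_psi.
Proof.
suff e : hom_comp F5_psi F5_phi =1 hom_id _.
  by move=> x; rewrite -hom_compE e hom_idE.
apply: F5_hom_eq => k k5; rewrite hom_compE hom_idE F5_phiE //.
case: k k5 => [|[|[|[|[|//]]]]] _ /=; rewrite ?hom_torus_word !F5_psiE //=.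
by rewrite /torus_word /torus_coword !gnorm.
Qed.

Lemma F5_psiK : cancel F5_psi F5_phi.
Proof.
suff e : hom_comp F5_phi F5_psi =1 hom_id _.
  by move=> x; rewrite -hom_compE e hom_idE.
apply: F5_hom_eq => k k5; rewrite hom_compE hom_idE F5_psiE //.
case: k k5 => [|[|[|[|[|//]]]]] _ /=; rewrite ?hom_torus_coword !F5_phiE //=.
by rewrite /torus_word /torus_coword !gnorm.
Qed.

Definition torus : groupType := mapping_torus F5_phiK F5_psiK.
Definition torus_a : torus := torus_shift F5_phiK F5_psiK.
Definition torus_y : torus := torus_base F5_phiK F5_psiK (F5_gen 0).

(** Conjugation by [torus_a^-1] acts as [F5_phi], so y_5 is the image of the torus word by
    construction; comparison with [torus_wordE] leaves a trivial conjugate of the relator. *)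
Lemma torus_relation : [~ torus_a, K2_word torus_a torus_y] = 1.
Proof.
pose b := torus_base F5_phiK F5_psiK.
have bS k : (k < 4)%N -> b (F5_gen k.+1) = b (F5_gen k) ^ torus_a^-1.
  move=> k4; rewrite -[RHS]torus_base_shift F5_phiE; last exact: ltnW.
  by move: k k4 => [|[|[|[|]]]].
have y_ (m : nat) : (m < 5)%N -> torus_y ^ (torus_a^-1 ^+ m) = b (F5_gen m).
  elim: m => [_|m IH m4]; first by rewrite expg0 conjg1.
  by rewrite expgSr conjgM (IH (ltnW m4)) -bS.
have y5 : torus_y ^ (torus_a^-1 ^+ 5) =
    torus_word (b (F5_gen 0)) (b (F5_gen 1)) (b (F5_gen 2)) (b (F5_gen 3))
      (b (F5_gen 4)).
  rewrite expgSr conjgM y_ // -[LHS]torus_base_shift F5_phiE //=.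
  exact: hom_torus_word.
have := torus_wordE torus_a torus_y; rewrite /= y5 !y_ //.
rewrite -{1}[torus_word _ _ _ _ _]mulg1 => /mulgI/esym/eqP.
by rewrite conjg_eq1 => /eqP.
Qed.

Definition K2_to_torus : hom G_K2 torus := K2_hom torus_relation.

Definition F5_to_K2 : hom (F_ 5) G_K2 :=
  free_hom (fun i : 'I_5 => K2y ^ (K2a^-1 ^+ i)).

Lemma F5_to_K2_gen k : (k < 5)%N -> F5_to_K2 (F5_gen k) = K2y ^ (K2a^-1 ^+ k).
Proof. by move=> k5; rewrite free_hom_gen inordK. Qed.

(** The compatibility needed by [torus_hom]. On the first four generators it is the shift of
    exponents; on the last one it is the relation of the knot group. *)
Lemma F5_to_K2_phi x : F5_to_K2 (F5_phi x) = F5_to_K2 x ^ K2a^-1.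
Proof.
rewrite -hom_compE -hom_conjE -[RHS]hom_compE; move: x.
apply: F5_hom_eq => k k5.
rewrite !hom_compE hom_conjE F5_phiE // F5_to_K2_gen //.
rewrite -conjgM -expgSr.
case: k k5 => [|[|[|[|[|//]]]]] _; rewrite [nth _ _ _]/= ?F5_to_K2_gen //.
by rewrite hom_torus_word !F5_to_K2_gen // torus_wordE K2_relation conj1g mulg1.
Qed.

Definition torus_to_K2 : hom torus G_K2 :=
  torus_hom F5_phiK F5_psiK F5_to_K2_phi.

Lemma torus_to_K2K : cancel K2_to_torus torus_to_K2.
Proof.
suff e : hom_comp torus_to_K2 K2_to_torus =1 hom_id _.
  by move=> x; rewrite -hom_compE e hom_idE.
apply: generating_pair_hom_eq K2_generating_pair _ _; rewrite hom_compE hom_idE.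
  by rewrite K2_hom_a torus_homE /= gmulf1 mul1g.
rewrite K2_hom_y torus_homE /torus_y torus_baseE /= F5_to_K2_gen //.
by rewrite mulg1 conjg1.
Qed.

Lemma F5_to_K2K x : K2_to_torus (F5_to_K2 x) = torus_base F5_phiK F5_psiK x.
Proof.
rewrite -hom_compE; move: x; apply: F5_hom_eq => k k5.
rewrite hom_compE F5_to_K2_gen // gmulfJ gmulfXn gmulfV K2_hom_a K2_hom_y.
elim: k k5 => [_|k IH k5]; first by rewrite expg0 conjg1.
rewrite expgSr conjgM (IH (ltnW k5)) -[LHS]torus_base_shift.
rewrite F5_phiE; last exact: ltnW.
by move: k k5 {IH} => [|[|[|[|]]]].
Qed.

Definition K2_exponent : hom G_K2 Zinf :=
  hom_comp (torus_exponent F5_phiK F5_psiK) K2_to_torus.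

(** The subgroup is the kernel of the exponent of [a]. [F5_to_K2] is injective since its composite
    with [K2_to_torus] is the inclusion of the base, and it fills the kernel since an element of
    exponent 0 lies in the base of the torus. *)
Lemma K2_free_by_cyclic : exists N : normalClosed G_K2,
  isomorphic (F_ 5) (subgroup N) /\ isomorphic (quotient_group N) Zinf.
Proof.
exists [the normalClosed _ of hom_ker K2_exponent : {pred _}].
split; last first.
  apply: (@first_isomorphism _ _ _ K2_exponent) => // n.
  exists (expgz K2a n); rewrite hom_expgz hom_compE K2_hom_a torus_exponentE /=.
  (* The identity of [Zinf], read as a map to the additive integers, turns the n-th power of the
     generator 1 into n. *)
  rewrite (@expgz_additive Zinf int predT id) //; exact: intz.
have kerP x : F5_to_K2 x \in hom_ker K2_exponent.
  by rewrite mem_hom_ker hom_compE F5_to_K2K torus_baseE torus_exponentE.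
pose j x : subgroup (hom_ker K2_exponent) := exist _ (F5_to_K2 x) (kerP x).
have jM : {morph j : x z / x * z}.
  by move=> x z; apply: val_inj; rewrite valM /= gmulfM.
apply: (@bij_isomorphic _ _ (hom_of jM)) => [x z|u].
  rewrite (hom_ofE jM x) (hom_ofE jM z).
  move=> /(congr1 val)/= /(congr1 K2_to_torus).
  by rewrite !F5_to_K2K => /torus_base_inj.
have := valP u; rewrite mem_hom_ker hom_compE torus_exponentE => /eqP u0.
exists (K2_to_torus (val u)).1; rewrite hom_ofE; apply: val_inj => /=.
rewrite -[RHS]torus_to_K2K torus_homE.
by rewrite u0 mulg1.
Qed.
End FreeByCyclic.

Theorem theorem4p3 :
  [/\ (forall i j : nat, 1 <= i <= 5 -> 1 <= j <= 5 -> i <> j ->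
         ~ (lcs G_K2 i =i lcs G_K2 j)),
      isomorphic (quotient_group (lcs G_K2 4)) (quotient_group (lcs (F_ 2) 4)),
      isomorphic (quotient_group (within (lcs G_K2 4) (lcs G_K2 5)))
                 (Zinf * Zinf * Z4)%type
    & ~ isomorphic (quotient_group (lcs G_K2 5))
                   (quotient_group (lcs (F_ 2) 5))]
  /\
  (exists N : normalClosed G_K2,
     isomorphic (F_ 5) (subgroup N) /\ isomorphic (quotient_group N) Zinf).
Proof.
split; last exact: K2_free_by_cyclic.
split; [exact: K2_lcs_distinct|exact: K2_mod_lcs4|exact: K2_lcs4_lcs5|].
exact: K2_mod_lcs5.
Qed.
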